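(* Consider a random forest (setting in the context) satisfying the following three assumptions. (A) For all $\ell\in\{1,\ldots,k\}$, all $\mathbf x\in\mathcal X$ and all $y\in\mathbb R$, $\ \sup_{\mathbf z\in A_n(\mathbf x;\Theta_\ell,\mathcal D_n)}|F(y|\mathbf z)-F(y|\mathbf x)|\to0$ a.s. as $n\to\infty$. (B) The number of trees satisfies $k=\mathcal O(n^\alpha)$ with $\alpha>0$, and at least one of the following holds: (B1) for all $\mathbf x\in\mathcal X$, $N_n^b(\mathbf x;\Theta,\mathcal D_n)=\Omega\big(\sqrt n(\ln n)^\beta\big)$ a.s., with $\beta>1$; (B2) for all $\mathbf x\in\mathcal X$, $\mathbb E[N_n^b(\mathbf x;\Theta,\mathcal D_n)]=\Omega\big(\sqrt n(\ln n)^\beta\big)$ with $\beta>1$, and $\mathrm{CV}\big(N_n^b(\mathbf x;\Theta,\mathcal D_n)\big)=\mathcal O\Big(\frac1{n^{(\alpha+1)/2}(\ln n)^{\gamma/2}}\Big)$ with $\gamma>1$. (C) For every $\mathbf x\in\mathcal X$, $y\mapsto F(y|\mathbf X=\mathbf x)$ is continuous and increasing. Then $$\forall\mathbf x\in\mathcal X,\quad\sup_{y\in\mathbb R}\left|F^o_{k,n}(y|\mathbf X=\mathbf x)-F(y|\mathbf X=\mathbf x)\right|\xrightarrow[n\to\infty]{a.s.}0 .$$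
   Context: **Setting.** $(\mathbf X,Y)$ is a random pair with values in $\mathcal X\times\mathbb R$, $\mathcal X=\prod_{i=1}^d[u_i,v_i]\subset\mathbb R^d$ a compact hyper-rectangle, and $F(y|\mathbf x)=F(y|\mathbf X=\mathbf x)=\mathbb P(Y\le y\mid\mathbf X=\mathbf x)$. For each $n$, $\mathcal D_n=(\mathbf X^j,Y^j)_{j=1,\ldots,n}$ are independent copies of $(\mathbf X,Y)$. The random vectors $\Theta_1,\ldots,\Theta_k$ ($k=k_n$) are independent copies of a generic $\Theta=(\Theta^1,\Theta^2)$ and independent of $\mathcal D_n$. $\Theta^1$ encodes a bootstrap sample: $n$ indices drawn uniformly with replacement from $\{1,\ldots,n\}$; $B_j(\Theta^1,\mathcal D_n)$ is the number of times observation $j$ is drawn, and $\mathcal D_n^\star(\Theta)$ is the bootstrap sample. $\Theta^2$ gives, at each node, a random set $\mathcal M_{try}\subset\{1,\ldots,d\}$ of candidate split variables, each covariate having positive probability of being selected. All objects live on a common probability space. **Trees.** For a rectangle $A=\prod_i[a_i,b_i]$ let $N_n^b(A)$ be the number (with multiplicity) of bootstrap observations with $\mathbf X^i\in A$, and $\overline Y_A$ the mean of their $Y$-values. With $A_L=\{\mathbf x\in A:x_j\le z\}$, $A_R=\{\mathbf x\in A:x_j>z\}$, the CART criterion is $$L_A^n(j,z)=\frac1{N_n^b(A)}\sum_{i=1}^nB_i\,(Y^i-\overline Y_A)^2\mathbf 1_{\{\mathbf X^i\in A\}}-\frac1{N_n^b(A)}\sum_{i=1}^nB_i\,\big(Y^i-\overline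 Y_{A_L}\mathbf 1_{\{X^i_j\le z\}}-\overline Y_{A_R}\mathbf 1_{\{X^i_j>z\}}\big)^2\mathbf 1_{\{\mathbf X^i\in A\}} .$$ The tree associated with $\Theta$ starts from the node $\mathcal X$ and recursively splits each node $A$ into $A_L,A_R$ with $(j,z)$ maximizing $L_A^n(j,z)$ over $j\in\mathcal M_{try}$, $z\in[a_j,b_j]$, until a stopping rule is reached; terminal nodes are leaves. $A_n(\mathbf x;\Theta,\mathcal D_n)$ is the leaf containing $\mathbf x$; $N_n^b(\mathbf x;\Theta,\mathcal D_n)$ is the number of elements of $\mathcal D_n^\star(\Theta)$ (with multiplicity) falling in it, and $N_n^o(\mathbf x;\Theta,\mathcal D_n)$ the number of points of $\mathcal D_n$ falling in it. **Estimator (trees are grown with the bootstrap samples; the original sample is used for estimation).** $$F^o_{k,n}(y|\mathbf X=\mathbf x)=\sum_{j=1}^n\Big(\frac1k\sum_{\ell=1}^k\frac{\mathbf 1_{\{\mathbf X^j\in A_n(\mathbf x;\Theta_\ell,\mathcal D_n)\}}}{N_n^o(\mathbf x;\Theta_\ell,\mathcal D_n)}\Big)\mathbf 1_{\{Y^j\le y\}} .$$ **Notation.** $f(n)=\Omega(g(n))$ means there are $K>0$ and $n_0>0$ with $|f(n)|\ge K|g(n)|$ for all $n\ge n_0$. $\mathrm{CV}(X)=\sigma_X/\mathbb E[X]$, with $\sigma_X$ the standard deviation of $X$. *)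

(* Defs.v *)
From HB Require Import structures.
From mathcomp Require Import all_boot all_order all_algebra.
From mathcomp Require Import all_classical all_reals all_analysis.

Set Implicit Arguments.
Unset Strict Implicit.
Unset Printing Implicit Defensive.

Import Order.TTheory GRing.Theory Num.Theory.
Import numFieldNormedType.Exports.

Local Open Scope classical_set_scope.
Local Open Scope ring_scope.

(* Points of R^d are d-tuples, which the library equips with the product
   (Borel) sigma-algebra; an observation is a pair (x, y), a sample of size n
   an n-tuple of observations.  Indices start at 0. *)
Notation xvec R d := (d.-tuple R%type) (only parsing).
Notation obs R d := (d.-tuple R%type * R%type)%type (only parsing).

Section Laws.
Context d (Omega : measurableType d) (R : realType) (P : probability Omega R).

Definition same_law d' (T : measurableType d') (f g : Omega -> T) :=
  forall B : set T, measurable B -> P (f @^-1` B) = P (g @^-1` B).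

Definition sigma_of d' (T : measurableType d') (f : Omega -> T) :
    set (set Omega) :=
  preimage_set_system [set: Omega] f measurable.

Definition mutually_independent (I : choiceType) (C : I -> set (set Omega)) :=
  forall (s : seq I) (E : I -> set Omega), uniq s ->
    (forall i, i \in s -> C i (E i)) ->
    P (\bigcap_(i in [set` s]) E i) = (\prod_(i <- s) P (E i))%E.

Definition joint_family d1 d2 (T1 : measurableType d1) (T2 : measurableType d2)
    (I J : Type) (f : I -> Omega -> T1) (g : J -> Omega -> T2)
    (i : I + J) : set (set Omega) :=
  match i with inl a => sigma_of (f a) | inr b => sigma_of (g b) end.

(* Q is a regular version of the conditional law of Y given X. *)
Definition conditional_law d' (T : measurableType d') (X : Omega -> T)
    (Y : Omega -> R) (Q : R.-pker T ~> R) :=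
  forall (A : set T) (B : set R), measurable A -> measurable B ->
    P (X @^-1` A `&` Y @^-1` B) = (\int[P]_(w in X @^-1` A) Q (X w) B)%E.

Definition CV (f : Omega -> R) : R :=
  Num.sqrt (fine ('V_P[f])%E) / fine ('E_P[f])%E.

End Laws.

Definition cond_cdf (R : realType) d' (T : measurableType d')
    (Q : R.-pker T ~> R) (y : R) (x : T) : R := fine (Q x `]-oo, y]%classic).

Section Trees.
Context (R : realType) (d : nat).

(* A node of a tree: the bounds a_i, b_i of its rectangle, and the set of its
   points; after splits some lower faces do not belong to that set. *)
Record node := Node {
  lower : 'I_d -> R;
  upper : 'I_d -> R;
  region : set (xvec R d) }.

Definition box (u v : 'I_d -> R) : set (xvec R d) :=
  [set x | forall i, u i <= tnth x i <= v i].

Definition root_node (u v : 'I_d -> R) : node := Node u v (box u v).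

Definition node_left (A : node) (j : 'I_d) (z : R) : node :=
  Node (lower A) (fun i => if i == j then z else upper A i)
       (region A `&` [set x | tnth x j <= z]).

Definition node_right (A : node) (j : 'I_d) (z : R) : node :=
  Node (fun i => if i == j then z else lower A i) (upper A)
       (region A `&` [set x | z < tnth x j]).

Section Sample.
(* s lists the indices drawn by the bootstrap. *)
Context (n : nat) (s : {ffun 'I_n -> 'I_n}) (D : n.-tuple (obs R d)).

Definition xs (i : 'I_n) : xvec R d := (tnth D i).1.
Definition ys (i : 'I_n) : R := (tnth D i).2.

Definition resample : n.-tuple (obs R d) := [tuple tnth D (s i) | i < n].

Definition mult (j : 'I_n) : nat := #|[pred i | s i == j]|.

Definition Nb (A : set (xvec R d)) : nat :=
  (\sum_(i < n | xs i \in A) mult i)%N.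

Definition No (A : set (xvec R d)) : nat := #|[pred i | xs i \in A]|.

(* Equal to 0 when A contains no bootstrap observation. *)
Definition ybar (A : set (xvec R d)) : R :=
  (\sum_(i < n | xs i \in A) (mult i)%:R * ys i) / (Nb A)%:R.

Definition cart_criterion (A : node) (j : 'I_d) (z : R) : R :=
  (Nb (region A))%:R^-1 *
    (\sum_(i < n | xs i \in region A)
       (mult i)%:R * (ys i - ybar (region A)) ^+ 2)
  - (Nb (region A))%:R^-1 *
    (\sum_(i < n | xs i \in region A)
       (mult i)%:R *
         (ys i - ybar (region (node_left A j z)) * (tnth (xs i) j <= z)%R%:R
               - ybar (region (node_right A j z)) * (z < tnth (xs i) j)%R%:R) ^+ 2).

End Sample.

Inductive tree := Leaf | Split (j : 'I_d) (z : R) (l r : tree).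

Definition cart_split n (s : {ffun 'I_n -> 'I_n}) (D : n.-tuple (obs R d))
    (M : {set 'I_d}) (A : node) (j : 'I_d) (z : R) : Prop :=
  [/\ j \in M, lower A j <= z <= upper A j &
      forall j' z', j' \in M -> lower A j' <= z' <= upper A j' ->
        cart_criterion s D A j' z' <= cart_criterion s D A j z].

(* Nodes are addressed by the sequence of turns from the root, false being a
   left turn.  M gives the candidate variables at each address; stop is the
   stopping rule, which sees the bootstrap sample only.  The choice among
   several maximizers is left free. *)
Fixpoint cart_tree n (s : {ffun 'I_n -> 'I_n}) (D : n.-tuple (obs R d))
    (M : seq bool -> {set 'I_d})
    (stop : n.-tuple (obs R d) -> seq bool -> node -> bool)
    (a : seq bool) (A : node) (t : tree) : Prop :=
  match t with
  | Leaf => stop (resample s D) a A \/ M a = finset.set0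
  | Split j z l r =>
      [/\ ~~ stop (resample s D) a A,
          cart_split s D (M a) A j z,
          cart_tree s D M stop (rcons a false) (node_left A j z) l &
          cart_tree s D M stop (rcons a true) (node_right A j z) r]
  end.

Fixpoint leaf (t : tree) (A : node) (x : xvec R d) : set (xvec R d) :=
  match t with
  | Leaf => region A
  | Split j z l r =>
      if tnth x j <= z then leaf l (node_left A j z) x
      else leaf r (node_right A j z) x
  end.

(* F^o_{k,n}(y|x), where L l is the leaf of x in the l-th tree. *)
Definition forest_cdf n (D : n.-tuple (obs R d)) (k : nat)
    (L : nat -> set (xvec R d)) (y : R) : R :=
  \sum_(j < n)
    (k%:R^-1 * \sum_(l < k) (xs D j \in L l)%:R / (No D (L l))%:R) *
    (ys D j <= y)%R%:R.

End Trees.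

Definition rate (R : realType) (beta : R) (n : nat) : R :=
  Num.sqrt n%:R * (ln n%:R) `^ beta.

(* Main.v *)
(* Write the forest estimate as the average over the trees of the
   empirical c.d.f. of the leaf.

   One tree.  (B2) implies (B1) by Chebyshev and Borel-Cantelli.  With L = log2 n, almost
   surely no observation is drawn L times by the bootstrap for n large, so N^b >= L^3
   gives N^o >= L^2.  A leaf meets the sample in one of at most n^(2d) sets of points,
   all determined by the covariates.  Conditionally on the covariates the responses are
   independent, so for a set of m >= L^2 points whose conditional probabilities
   F(y|X^j) are at most p, a Chernoff bound makes a frequency of {Y^j <= y} exceeding
   p + eps exponentially unlikely in m, which survives the union bound over the sets.
   Applied to {Y <= y} and to its complement, with (A), this shows that the mean of
   the leaf converges to F(y|x).

   Many trees.  (A) and (B1) are not uniform in the tree.  But for one tree the event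
   "bad at some time n >= N" has probability tending to 0 as N grows, hence so has its
   conditional probability given the data; given the data the trees are independent,
   so Chernoff and Borel-Cantelli bound the proportion of such trees among the first K,
   for all large K.  The finitely many smaller K are handled tree by tree.

   Uniformity in y is Polya's argument on a countable grid of quantiles. *)

Require Import Defs.
From HB Require Import structures.
From mathcomp Require Import all_boot all_order all_algebra.
From mathcomp Require Import all_classical all_reals all_analysis.
From mathcomp Require Import measurable_realfun ring lra.

Set Implicit Arguments.
Unset Strict Implicit.
Unset Printing Implicit Defensive.

Import Order.TTheory GRing.Theory Num.Theory.
Import numFieldNormedType.Exports.

Local Open Scope classical_set_scope.
Local Open Scope ring_scope.

(** * Independence of one index from all the others, and Fubini's theorem for it *)

Section Independence.
Context d (Omega : measurableType d) (R : realType) (P : probability Omega R).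

Section FromMutual.
Context (I : choiceType) (C : I -> set (set Omega)).
Hypothesis C_measurable : forall i, C i `<=` measurable.
Hypothesis C_T : forall i, C i [set: Omega].
Hypothesis C_I : forall i, setI_closed (C i).
Hypothesis C_indep : mutually_independent P C.

Definition others (i0 : I) : set (set Omega) :=
  \bigcup_(i in [set i | i != i0]) C i.

(** A pi-system containing every event of [others i0], on which mutual independence gives the
    product rule directly. *)
Let finite_meets (i0 : I) : set (set Omega) :=
  [set W | exists s (E : I -> set Omega), [/\ uniq s, i0 \notin s,
     forall i, i \in s -> C i (E i) & W = \bigcap_(i in [set` s]) E i]].

Let finite_meetsI i0 : setI_closed (finite_meets i0).
Proof.
move=> _ _ [s [E [us s0 CE ->]]] [s' [E' [us' s0' CE' ->]]].
pose F (t : seq I) (G : I -> set Omega) i := if i \in t then G i else setT.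
exists (undup (s ++ s')), (fun i => F s E i `&` F s' E' i); split.
- exact: undup_uniq.
- by rewrite mem_undup mem_cat negb_or s0.
- move=> i _; apply: C_I; rewrite /F; case: ifPn => // ?;
    [exact: CE|exact: CE'].
- apply/seteqP; split=> w /=.
    move=> [Ew E'w] i; rewrite /F /= => _.
    by split; case: ifPn => // ?; [exact: Ew|exact: E'w].
  move=> H; split=> i /= i_s; have := H i;
    rewrite /= mem_undup mem_cat i_s ?orbT /F => /(_ isT) [];
    by rewrite i_s.
Qed.

Let finite_meets_measurable i0 : finite_meets i0 `<=` measurable.
Proof.
move=> _ [s [E [us s0 CE ->]]]; apply: fin_bigcap_measurable => // i is_.
exact: (C_measurable (CE _ is_)).
Qed.

Lemma others_sub_meets i0 : <<s others i0 >> `<=` <<s finite_meets i0 >>.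
Proof.
apply: smallest_sub; first exact: smallest_sigma_algebra.
move=> W [i /= i0i CW]; apply: sub_sigma_algebra.
exists [:: i], (fun=> W); split => //.
- by rewrite inE eq_sym.
- by move=> j; rewrite inE => /eqP ->.
- by apply/seteqP; split=> w; [move=> ? i' _ //|move/(_ i); apply; rewrite /= inE].
Qed.

(** As functions of [W] both sides are finite measures, [P] restricted to [E] and [P] scaled by
    [P E]. They agree on the finite meets, hence on the sigma-algebra that these generate. *)
Lemma independent_of_others i0 W E : <<s others i0 >> W -> C i0 E ->
  P (W `&` E) = (P W * P E)%E.
Proof.
move=> /others_sub_meets sW CE.
have mE := C_measurable CE.
have PEfin : P E \is a fin_num by exact: fin_num_measure.
have nng : 0 <= fine (P E) by exact: fine_ge0.
pose c := NngNum nng.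
have -> : P (W `&` E) = mrestr P mE W by [].
have -> : (P W * P E)%E = mscale c P W by rewrite /mscale /= fineK // muleC.
apply: (g_sigma_algebra_measure_unique (finite_meets i0) _ (fun=> setT)) sW => //.
- move=> _; exists [::], (fun=> setT); split => //.
  by apply/seteqP; split=> w.
- by apply/seteqP; split=> // w _; exists 0%N.
- move=> A [s [F [us s0 CF ->]]]; rewrite /mrestr /mscale /=.
  rewrite -[X in _ = (X * _)%E]/((fine (P E))%:E) fineK //.
  pose G i := if i == i0 then E else F i.
  have GF i : i \in s -> G i = F i.
    by move=> i_s; rewrite /G ifN //; apply: contraNneq s0 => <-.
  transitivity (P (\bigcap_(i in [set` i0 :: s]) G i)).
    congr (P _); apply/seteqP; split=> w /=.
      move=> [Fw Ew] i; rewrite /= inE => /orP[/eqP->|i_s].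
        by rewrite /G eqxx.
      by rewrite GF //; exact: Fw.
    move=> H; split; last by have := H i0; rewrite /= inE eqxx /G eqxx; exact.
    by move=> i /= i_s; rewrite -GF //; apply: H; rewrite /= inE i_s orbT.
  rewrite C_indep /=; last 2 first.
  - by rewrite s0.
  - move=> i; rewrite inE => /orP[/eqP->|i_s]; first by rewrite /G eqxx.
    by rewrite GF //; exact: CF.
  rewrite big_cons /G eqxx C_indep //; congr (_ * _)%E.
  by apply: eq_big_seq => i /GF; rewrite /G => ->.
- move=> _; change (P (setT `&` E) < +oo)%E.
  by rewrite setTI ltey_eq fin_num_measure.
Qed.

End FromMutual.

Section Fubini.
Context (G : set (set Omega)) dT (T : measurableType dT) (V : {mfun Omega >-> T}).
Hypothesis G_measurable : G `<=` measurable.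
Hypothesis G_V_indep : forall W A, <<s G >> W -> measurable A ->
  P (W `&` V @^-1` A) = (P W * P (V @^-1` A))%E.

(** [Omega] with the sigma-algebra generated by [G]: a measurable set of [OG * T] uses only the
    information in [G] through its first coordinate. *)
Let OG := g_sigma_algebraType G.

Lemma sigma_sub_measurable : <<s G >> `<=` measurable.
Proof. exact: (smallest_sub (@sigma_algebra_measurable _ Omega) G_measurable). Qed.

Lemma to_sigma_measurable : measurable_fun setT (id : Omega -> OG).
Proof. by move=> _ A mA; rewrite setTI; exact: sigma_sub_measurable. Qed.

Let idG : {mfun Omega >-> OG} := HB.pack_for {mfun Omega >-> OG}
  (id : Omega -> OG) (isMeasurableFun.Build _ _ Omega OG id to_sigma_measurable).

Lemma graph_measurable :
  measurable_fun setT (fun w => (w, V w) : (OG * T)%type).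
Proof.
apply: measurable_fun_pair; first exact: to_sigma_measurable.
exact: measurable_funPT.
Qed.

Let graph : {mfun Omega >-> (OG * T)%type} :=
  HB.pack_for {mfun Omega >-> (OG * T)%type}
  (fun w => (w, V w) : (OG * T)%type)
  (isMeasurableFun.Build _ _ Omega (OG * T)%type _ graph_measurable).

Lemma preimage_graph_measurable (B : set (OG * T)) : measurable B ->
  measurable [set w | B (w, V w)].
Proof. by move=> mB; rewrite -[X in measurable X]setTI; exact: graph_measurable. Qed.

Lemma section_prob_measurable (B : set (OG * T)) : measurable B ->
  measurable_fun setT ((fun w => P (V @^-1` xsection B w)) : OG -> \bar R).
Proof. exact: (measurable_fun_xsection (distribution P V)). Qed.

Lemma section_prob_measurable_base (B : set (OG * T)) : measurable B ->
  measurable_fun setT ((fun w => P (V @^-1` xsection B w)) : Omega -> \bar R).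
Proof.
move=> mB; apply: (measurableT_comp (section_prob_measurable mB)).
exact: to_sigma_measurable.
Qed.

(** By independence the law of the pair (identity, [V]) is a product measure. The integrand, where
    [w] is frozen, is the conditional probability given [G]; this formula replaces conditioning in
    what follows. *)
Lemma independent_fubini (B : set (OG * T)) : measurable B ->
  P [set w | B (w, V w)] = (\int[P]_w P (V @^-1` xsection B w))%E.
Proof.
move=> mB; transitivity ((distribution P idG \x distribution P V)%E B).
  rewrite (@product_measure_unique _ _ _ _ _ _ _ (distribution P graph)) //.
rewrite /product_measure1 /= ge0_integral_distribution //.
exact: section_prob_measurable.
Qed.

End Fubini.
End Independence.

(** * A Chernoff bound from the probabilities of intersections *)

Section Chernoff.
Context d (Omega : measurableType d) (R : realType) (P : probability Omega R).

Lemma combination_integral (I : finType) (c : I -> R) (A : I -> set Omega) :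
  (forall i, measurable (A i)) -> (forall i, 0 <= c i) ->
  ((\sum_i c i * fine (P (A i)))%:E = \int[P]_w (\sum_i c i * \1_(A i) w)%:E)%E.
Proof.
move=> mA c0.
have mc i : measurable_fun setT (fun w => (c i * \1_(A i) w)%:E).
  by apply/measurable_EFinP; apply: measurable_funM.
have c1 i w : setT w -> (0 <= (c i * \1_(A i) w)%:E)%E.
  by move=> _; rewrite lee_fin mulr_ge0.
under [RHS]eq_integral do rewrite -sumEFin.
rewrite (ge0_integral_sum P measurableT mc c1) -sumEFin; apply: eq_bigr => i _.
rewrite EFinM fineK ?fin_num_measure // -[in LHS](setIT (A i)).
rewrite -(integral_indic P measurableT (mA i)) -ge0_integralZl ?lee_fin //.
exact/measurable_EFinP.
Qed.

(** Pointwise inequalities between combinations of indicators are integrated once here; the union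
    bounds and the Chernoff bound then reduce to pointwise statements. *)
Lemma combination_le (I J : finType) (c : I -> R) (e : J -> R)
    (A : I -> set Omega) (B : J -> set Omega) :
  (forall i, measurable (A i)) -> (forall j, measurable (B j)) ->
  (forall i, 0 <= c i) -> (forall j, 0 <= e j) ->
  (forall w, \sum_i c i * \1_(A i) w <= \sum_j e j * \1_(B j) w) ->
  \sum_i c i * fine (P (A i)) <= \sum_j e j * fine (P (B j)).
Proof.
move=> mA mB c0 e0 H; rewrite -lee_fin !combination_integral //.
apply: ge0_le_integral => //.
- by move=> w _; rewrite lee_fin sumr_ge0 // => i _; rewrite mulr_ge0.
- apply/measurable_EFinP; apply: measurable_sum => i; exact: measurable_funM.
- apply/measurable_EFinP; apply: measurable_sum => i; exact: measurable_funM.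
- by move=> w _; rewrite lee_fin; exact: H.
Qed.

Lemma prob_le_combination (I : finType) (c : I -> R) (A : I -> set Omega)
    (S : set Omega) :
  measurable S -> (forall i, measurable (A i)) -> (forall i, 0 <= c i) ->
  (forall w, S w -> 1 <= \sum_i c i * \1_(A i) w) ->
  fine (P S) <= \sum_i c i * fine (P (A i)).
Proof.
move=> mS mA c0 H.
have := @combination_le unit I (fun=> 1) c (fun=> S) A (fun=> mS) mA (fun=> ler01) c0.
rewrite big_const card_unit /= addr0 mul1r; apply => w.
rewrite big_const card_unit /= addr0 mul1r indicE.
case: (boolP (w \in S)) => [/set_mem/H //|_].
by apply: sumr_ge0 => i _; rewrite mulr_ge0.
Qed.

Lemma sum_disjoint_prob_le1 (I : finType) (A : I -> set Omega) :
  (forall i, measurable (A i)) -> (forall i j w, A i w -> A j w -> i = j) ->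
  \sum_i fine (P (A i)) <= 1.
Proof.
move=> mA disj.
have := @combination_le I unit (fun=> 1) (fun=> 1) A (fun=> setT) mA
  (fun=> measurableT) (fun=> ler01) (fun=> ler01).
rewrite big_const card_unit /= addr0 mul1r probability_setT.
under eq_bigr do rewrite mul1r.
apply => w; rewrite big_const card_unit /= addr0 mul1r indicT.
have [[i Ai]|nA] := pselect (exists i, A i w).
  rewrite (bigD1 i) //= big1 => [|j ji]; first by rewrite indicE mem_set // mulr1 addr0.
  rewrite indicE memNset ?mulr0 // => Aj.
  by move: ji; rewrite (disj _ _ _ Aj Ai) eqxx.
rewrite big1 => [|i _]; first exact: ler01.
by rewrite indicE memNset ?mulr0 // => Ai; apply: nA; exists i.
Qed.

Context (I : finType) (E : I -> set Omega) (S : set Omega) (p : R).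
Hypothesis mE : forall i, measurable (E i).
Hypothesis mS : measurable S.
Hypothesis p0 : 0 <= p.

Let meet (J : {set I}) := \bigcap_(i in [set` J]) E i.

Let meet_measurable J : measurable (meet J).
Proof. by apply: fin_bigcap_measurable. Qed.

Let meetU1 i J : meet (i |: J)%SET = meet J `&` E i.
Proof.
apply/seteqP; split=> w /=.
  move=> H; split; last by apply: H; rewrite /= !inE eqxx.
  by move=> j /= jJ; apply: H; rewrite /= !inE jJ orbT.
by move=> [H Ei] j; rewrite /= !inE => /orP[/eqP->|/H].
Qed.

(** Induction on a subset of [J], removing one index at a time at the cost of a factor [p]. The
    hypothesis is a one-step conditional bound, the form that [trace_step] and [label_step]
    provide. *)
Lemma prob_meet_le (J : {set I}) :
  (forall (J' : {set I}) i, J' \subset J -> i \in J -> i \notin J' ->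
    fine (P (S `&` meet J' `&` E i)) <= p * fine (P (S `&` meet J'))) ->
  fine (P (S `&` meet J)) <= p ^+ #|J| * fine (P S).
Proof.
move=> H; suff Hs (J' : {set I}) : J' \subset J ->
    fine (P (S `&` meet J')) <= p ^+ #|J'| * fine (P S) by exact: Hs.
move cJ : #|J'| => m; elim: m J' cJ => [|m IHm] J' cJ sJ.
  rewrite expr0 mul1r fine_le ?fin_num_measure //; try exact: measurableI.
  apply: le_measure; rewrite ?inE //; exact: measurableI.
have [i iJ'] : exists i, i \in J' by apply/card_gt0P; rewrite cJ.
rewrite -(finset.setD1K iJ') meetU1 setIA exprS -mulrA.
have sJ' : (J' :\ i)%SET \subset J by apply: fintype.subset_trans sJ; exact: finset.subD1set.
have iJ : i \in J by exact: (fintype.subsetP sJ).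
have ni : i \notin (J' :\ i)%SET by rewrite !inE eqxx.
apply: le_trans (H _ _ sJ' iJ ni) _.
apply: ler_wpM2l => //; apply: IHm => //.
by move: cJ; rewrite (cardsD1 i J') iJ' => -[].
Qed.

Lemma chernoff_meets (J : {set I}) (eps : R) : 0 <= p <= 1 -> 0 <= eps <= 1 ->
  (forall J' : {set I}, J' \subset J ->
    fine (P (S `&` meet J')) <= p ^+ #|J'| * fine (P S)) ->
  fine (P (S `&` [set w | (p + eps) * #|J|%:R <= \sum_(j in J) \1_(E j) w]))
    <= expR (- (eps ^+ 2 / 8)) ^+ #|J| * fine (P S).
Proof.
move=> /andP[_ p1] /andP[e0 e1] H.
(* Markov's inequality for exp(s * count), whose expansion over subsets of J only
   involves the probabilities of the meets. *)
pose s := eps / 4; pose a := expR s - 1.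
pose k := expR (- (s * (p + eps) * #|J|%:R)).
(* [b] vanishes off [J], so that the expansion over all subsets of [I] keeps only those of [J]. *)
pose b (j : I) := a * (j \in J)%:R.
have s0 : 0 <= s by rewrite /s; lra.
have a0 : 0 <= a by rewrite subr_ge0 (le_trans _ (expR_ge1Dx s)) // lerDl.
have b0 j : 0 <= b j by rewrite mulr_ge0.
have mcount : measurable_fun setT (fun w => \sum_(j in J) (\1_(E j) w : R)).
  under eq_fun do rewrite big_mkcond.
  apply: measurable_sum => j; case: (j \in J); last exact: measurable_cst.
  exact: measurable_indic (mE j).
apply: (@le_trans _ _
  (\sum_(J' : {set I}) (k * \prod_(j in J') b j) * fine (P (S `&` meet J')))).
  apply: prob_le_combination.
  - apply: measurableI => //; rewrite -[X in measurable X]setTI.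
    exact: (measurable_fun_le measurableT (measurable_cst _) mcount).
  - by move=> J'; exact: measurableI.
  - by move=> J'; rewrite mulr_ge0 ?expR_ge0 ?prodr_ge0.
  move=> w [Sw /= Hw].
  have -> : \sum_(J' : {set I}) (k * \prod_(j in J') b j) * \1_(S `&` meet J') w
      = k * \prod_j (b j * \1_(E j) w + 1).
    rewrite bigA_distr mulr_sumr; apply: eq_bigr => J' _.
    rewrite -mulrA -big_mkcond [in RHS]big_split /=; congr (_ * (_ * _)).
    case: (pselect (meet J' w)) => [mw|nmw].
      rewrite indicE mem_set // big1 // => j jJ'.
      by rewrite indicE mem_set //; exact: mw.
    rewrite indicE memNset; last by case.
    have [j jJ' nE] : exists2 j, j \in J' & ~ E j w.
      by apply: contra_notP nmw => nex j jJ'; apply: contrapT => nE; apply: nex; exists j.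
    by rewrite (bigD1 j) //= indicE memNset // mul0r.
  have -> : \prod_j (b j * \1_(E j) w + 1) = expR (s * \sum_(j in J) \1_(E j) w).
    rewrite mulr_sumr expR_sum [RHS]big_mkcond; apply: eq_bigr => j _.
    rewrite /b; case: ifP => _; last by rewrite mulr0 mul0r add0r.
    by rewrite mulr1 indicE; case: (w \in _); rewrite ?mulr1 ?mulr0 ?expR0 ?add0r // subrK.
  rewrite /k -expRD -[leLHS]expR0 ler_expR addrC subr_ge0 -mulrA.
  exact: ler_wpM2l.
apply: (@le_trans _ _ (k * (1 + a * p) ^+ #|J| * fine (P S))).
  have -> : (1 + a * p) ^+ #|J| =
      \sum_(J' : {set I}) \prod_(j in J') b j * p ^+ #|J'|.
    transitivity (\prod_j (b j * p + 1)).
      rewrite -prodr_const big_mkcond; apply: eq_bigr => j _.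
      by rewrite /b; case: (j \in J); rewrite ?mulr1 ?mulr0 ?mul0r ?add0r // addrC.
    rewrite bigA_distr; apply: eq_bigr => J' _.
    by rewrite -big_mkcond big_split /= prodr_const.
  rewrite mulr_sumr mulr_suml; apply: ler_sum => J' _.
  rewrite -!mulrA ler_wpM2l ?expR_ge0 //.
  have [sJ|/subsetPn[j jJ' njJ]] := boolP (J' \subset J).
    by rewrite ler_wpM2l ?prodr_ge0 //; exact: H.
  by rewrite (bigD1 j) //= /b (negbTE njJ) mulr0 !mul0r.
apply: ler_wpM2r; first exact: fine_ge0.
have -> : k = expR (- (s * (p + eps))) ^+ #|J|.
  by rewrite /k -expRM_natl mulrN mulrC.
rewrite -exprMn lerXn2r ?nnegrE ?mulr_ge0 ?expR_ge0 ?addr_ge0 ?mulr_ge0 //.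
apply: (@le_trans _ _ (expR (- (s * (p + eps))) * expR (a * p))).
  by rewrite ler_wpM2l ?expR_ge0 ?expR_ge1Dx.
rewrite -expRD ler_expR.
(* This follows from [expR s * (1 - s) <= 1] and [s <= 1 / 4]. As [p <= 1], the exponent
   [a * p - s * (p + eps)] is then at most [2 * s ^+ 2 - s * eps], which equals [- (eps ^+ 2 / 8)]
   for [s = eps / 4]. *)
have a_le : a <= s + 2 * s ^+ 2.
  have s1 : s <= 1 / 4 by rewrite /s; lra.
  have : expR s * (1 - s) <= 1.
    apply: (@le_trans _ _ (expR s * expR (- s))); last by rewrite -expRD subrr expR0.
    by rewrite ler_wpM2l ?expR_ge0 ?expR_ge1Dx.
  by rewrite /a; nra.
have : a * p <= (s + 2 * s ^+ 2) * p by rewrite ler_wpM2r.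
by rewrite /s in s0 a_le *; nra.
Qed.

End Chernoff.

(** * Borel-Cantelli under an eventual summable bound *)

Section BorelCantelli.
Context d (Omega : measurableType d) (R : realType) (P : probability Omega R).

Lemma borel_cantelli_ae (F : (set Omega)^nat) (b : R^nat) (M : R) :
  (forall n, measurable (F n)) -> (forall n, 0 <= b n) ->
  (forall n, \sum_(i < n) b i <= M) ->
  (\forall n \near \oo, fine (P (F n)) <= b n) ->
  {ae P, forall w, \forall n \near \oo, ~ F n w}.
Proof.
move=> mF b0 bM [N _ Fb].
(* The finitely many events that may escape the bound [b] are emptied, which leaves the limsup
   unchanged. *)
pose G n := if (n < N)%N then set0 else F n.
have mG n : measurable (G n) by rewrite /G; case: ifP.
have Gb n : (P (G n) <= (b n)%:E)%E.
  rewrite /G; case: ltnP => [_|Nn]; first by rewrite measure0 lee_fin.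
  by rewrite -[leLHS]fineK ?fin_num_measure // lee_fin; exact: Fb.
exists (lim_sup_set G); split.
- apply: bigcap_measurable => // k _; exact: bigcup_measurable.
- apply: lim_sup_set_cvg0 => //; apply: (@le_lt_trans _ _ M%:E); last exact: ltry.
  apply: lime_le; first by apply: is_cvg_nneseries => n _ _; exact: measure_ge0.
  apply: nearW => n; apply: (@le_trans _ _ (\sum_(0 <= i < n) (b i)%:E)%E).
    by apply: lee_sum => i _; exact: Gb.
  by rewrite sumEFin lee_fin big_mkord.
- move=> w /= Hw n _ /=; apply: contrapT => H; apply: Hw; exists (maxn n N) => //.
  move=> m /=; rewrite geq_max => /andP[nm Nm] Fm; apply: H; exists m => //=.
  by rewrite /G ltnNge Nm.
Qed.

End BorelCantelli.

(** * Summable bounds and comparisons of growth *)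

Section Asymptotics.
Context (R : realType).

(** A discrete comparison with the integral of [x ^ -(1 + a)]: each term is at most [1 / a] times
    the decrease of [x ^ -a] over a unit step. The remainder kept in [H] makes the sum telescope. *)
Lemma p_series_le (a : R) n : 0 < a ->
  \sum_(i < n) ((i.+1)%:R `^ (1 + a))^-1 <= 1 + a^-1 :> R.
Proof.
move=> a0.
suff H m : \sum_(i < m.+1) ((i.+1)%:R `^ (1 + a))^-1
    <= 1 + a^-1 * (1 - (m.+1)%:R `^ (- a)) :> R.
  case: n => [|n]; first by rewrite big_ord0 addr_ge0 // invr_ge0 ltW.
  apply: le_trans (H n) _; rewrite lerD2l -[leRHS]mulr1.
  by rewrite ler_wpM2l ?invr_ge0 ?ltW // gerBl powR_ge0.
elim: m => [|m IHm].
  by rewrite big_ord_recr big_ord0 /= !powR1 invr1 subrr mulr0 addr0 add0r.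
rewrite big_ord_recr /=; apply: le_trans (lerD IHm (lexx _)) _.
rewrite -addrA lerD2l -lerBrDl -mulrBr.
rewrite [X in _ * X](_ : _ = (m.+1)%:R `^ (- a) - (m.+2)%:R `^ (- a)); last by ring.
set x : R := (m.+1)%:R; set y : R := (m.+2)%:R.
have x0 : 0 < x by rewrite ltr0n.
have y0 : 0 < y by rewrite ltr0n.
have yx : y = x + 1 by rewrite /x /y -natr1.
rewrite ler_pdivlMl // -powRN opprD powRD; last by apply/implyP => _; rewrite gt_eqF.
rewrite powR_inv1 ?(ltW y0) //.
(* With this factorization the claim becomes [1 + a / y <= expR (a * (ln y - ln x))], a consequence
   of [1 / y <= ln y - ln x]. *)
have xE : x `^ (- a) = y `^ (- a) * expR (a * (ln y - ln x)).
  by rewrite /powR !gt_eqF // -expRD; congr expR; ring.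
rewrite xE -[X in _ - X]mulr1 -mulrBr [leLHS](_ : _ = y `^ (- a) * (a * y^-1)); last by ring.
rewrite ler_wpM2l ?powR_ge0 //.
have h1 : y^-1 <= ln y - ln x.
  have : ln (1 + - y^-1) <= - y^-1.
    by apply: le_ln1Dx; rewrite ltrN2 invf_lt1 // yx ltrDr.
  have -> : 1 + - y^-1 = x / y.
    have -> : x = y - 1 by rewrite yx addrK.
    by rewrite mulrBl divff ?gt_eqF // mul1r.
  by rewrite ln_div ?posrE // -lerN2 opprB opprK.
rewrite lerBrDl; apply: le_trans (expR_ge1Dx _); rewrite lerD2l.
by rewrite ler_wpM2l // ltW.
Qed.

Lemma inv_square_series_le n : \sum_(i < n) ((i.+1)%:R ^+ 2)^-1 <= 2 :> R.
Proof.
have := @p_series_le 1 n ltr01.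
under eq_bigr do rewrite -natr1 -[1 + 1]/(2%:R) powR_mulrn // natr1.
by rewrite invr1.
Qed.

(** The successor makes [n < 2 ^ log2 n] strict and the value positive, even at [n = 0]. *)
Definition log2 (n : nat) : nat := (trunc_log 2 n).+1.

Lemma ltn_log2 n : (n < 2 ^ log2 n)%N.
Proof. exact: trunc_log_ltn. Qed.

Lemma log2_ge m : \forall n \near \oo, (m <= log2 n)%N.
Proof.
exists (2 ^ m)%N => // n /= mn; apply: leqW.
exact: trunc_log_max.
Qed.

(** Past [m = 8] every new factor of the factorial exceeds 8; up to there the constant suffices
    alone. *)
Lemma expn8_fact m : (8 ^ m <= 8 ^ 8 * m`!)%N.
Proof.
elim: m => [|m IHm] //; rewrite factS expnS.
have [m8|m8] := leqP m 7.
  apply: (@leq_trans (8 ^ 8)); first by rewrite -expnS leq_exp2l.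
  by rewrite leq_pmulr // muln_gt0 fact_gt0.
rewrite mulnCA leq_mul //; exact: ltnW.
Qed.

(** The base 8 provides three powers of [2 ^ log2 n], which exceeds [n]: one absorbs the factor [n],
    two give summability. *)
Lemma log2_fact_small n :
  n%:R / ((log2 n)`!)%:R <= 8 ^+ 8 * ((n.+1)%:R ^+ 2)^-1 :> R.
Proof.
rewrite ler_pdivrMr ?ltr0n ?fact_gt0 // -mulrA mulrCA.
rewrite ler_pdivlMl ?exprn_gt0 ?ltr0n // -!natrX -!natrM ler_nat.
apply: leq_trans (expn8_fact _).
have := ltn_log2 n; rewrite -[8%N]/(2 ^ 3)%N -expnM (mulnC 3%N) expnM.
move: (2 ^ log2 n)%N => N nN; rewrite mulnC (expnS N 2) leq_mul //; first exact: ltnW.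
by rewrite leq_exp2r.
Qed.

(** Once [rho ^+ log2 n] is below the inverse of [2 ^ (p + 2)], its power [log2 n] is at most the
    inverse of [(2 ^ log2 n) ^ (p + 2)]. Here [p] factors absorb the union bound over [n ^ p] cases
    and two make the result summable. *)
Lemma log2_exp_small (rho : R) (p : nat) : 0 < rho < 1 ->
  \forall n \near \oo,
    (n ^ p)%:R * rho ^+ (log2 n ^ 2) <= ((n.+1)%:R ^+ 2)^-1.
Proof.
move=> /andP[r0 r1].
have : geometric 1 rho n @[n --> \oo] --> 0.
  by apply: cvg_geometric; rewrite gtr0_norm.
move=> /cvgr0Pnorm_lt /(_ ((2 ^ (p + 2))%:R^-1)).
rewrite invr_gt0 ltr0n expn_gt0 => /(_ isT) [m _ Hm].
have [N _ HN] := log2_ge m; exists N => // n /HN /Hm /=.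
rewrite mul1r ger0_norm ?exprn_ge0 ?(ltW r0) // => small.
rewrite natrX expnS expn1 exprM.
apply: (@le_trans _ _ (n%:R ^+ p * (((2 ^ log2 n)%:R ^+ (p + 2))^-1))).
  rewrite ler_wpM2l ?exprn_ge0 // -natrX -expnM mulnC expnM natrX -exprVn.
  by rewrite lerXn2r ?nnegrE ?exprn_ge0 ?invr_ge0 ?(ltW r0) ?(ltW small).
have := ltn_log2 n; move: (2 ^ log2 n)%N => M nM.
have M0 : 0 < M%:R :> R by rewrite ltr0n (leq_trans _ nM).
rewrite exprD invfM mulrA -[leRHS]mul1r ler_pM ?mulr_ge0 ?invr_ge0 ?exprn_ge0 //.
  by rewrite ler_pdivrMr ?exprn_gt0 // mul1r lerXn2r ?nnegrE // ler_nat ltnW.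
by rewrite lef_pV2 ?posrE ?exprn_gt0 ?ltr0Sn // lerXn2r ?nnegrE // ler_nat.
Qed.

(** The logarithmic factor of [rate] is eventually at least 1. After squaring, a sixth power of
    [log2 n] has to be compared with [n], which the seventh Taylor term of the exponential does. *)
Lemma rate_ge_log2_cube (K beta : R) : 0 < K -> 1 < beta ->
  \forall n \near \oo, (log2 n ^ 3)%:R <= K * rate beta n.
Proof.
move=> K0 b1; have l0 : 0 < ln 2 :> R by rewrite ln_gt0 // ltr1n.
(* [C <= l] bounds [64 * l ^ 6] by [K ^ 2] times the Taylor term [(l * ln 2) ^ 7 / 7!]; the 64 comes
   from [log2 n <= 2 * l]. The second summand of [m] ensures [ln n >= 1]. *)
pose C : R := 64 * (7`!)%:R / (K ^+ 2 * ln 2 ^+ 7).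
pose m := (Num.truncn C + Num.truncn ((ln 2)^-1 : R)).+3.
have [N _ HN] := log2_ge m; exists (maxn N 1) => // n /=.
rewrite geq_max => /andP[/HN/= mL n0].
set l := trunc_log 2 n.
have lC (c : R) : (Num.truncn c < l)%N -> c <= l%:R.
  by move=> cl; apply: ltW; apply: lt_le_trans (truncnS_gt c) _; rewrite ler_nat.
have {}mL : ((Num.truncn C + Num.truncn ((ln 2)^-1 : R)).+1 < l)%N by rewrite -ltnS.
have l1 : (0 < l)%N by apply: leq_trans mL.
have l2 : l%:R * ln 2 <= ln n%:R :> R.
  rewrite mulr_natl -lnXn ?ltr0n // ler_ln ?posrE ?exprn_gt0 ?ltr0n //.
  by rewrite -natrX ler_nat trunc_logP.
have ln1 : 1 <= ln n%:R :> R.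
  apply: le_trans l2; rewrite -ler_pdivrMr // mul1r; apply: lC.
  apply: leq_ltn_trans mL; rewrite -addnS; exact: leq_trans (leqnSn _) (leq_addl _ _).
have sq1 : (log2 n ^ 3)%:R <= K * Num.sqrt n%:R.
  have := lC C; rewrite (leq_ltn_trans _ mL) ?leqW ?leq_addr // => /(_ isT) Cl.
  rewrite -(@ler_pXn2r _ 2) ?nnegrE ?mulr_ge0 ?sqrtr_ge0 ?(ltW K0) //.
  rewrite exprMn sqr_sqrtr // -natrX -expnM.
  apply: (@le_trans _ _ (64 * l%:R ^+ 6)).
    have -> : 64 = 2 ^+ 6 :> R by ring.
    rewrite -exprMn -natrM -natrX ler_nat leq_exp2r // /log2 -/l mul2n -addnn.
    by rewrite -addn1 leq_add2l.
  apply: (@le_trans _ _ (K ^+ 2 * expR (l%:R * ln 2))); last first.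
    by rewrite ler_wpM2l ?exprn_ge0 ?(ltW K0) // -[leRHS]lnK ?posrE ?ltr0n // ler_expR.
  have := @expR_ge1Dxn R (l%:R * ln 2) 6; rewrite mulr_ge0 ?(ltW l0) // => /(_ isT).
  move=> h; apply: (@le_trans _ _ (K ^+ 2 * ((l%:R * ln 2) ^+ 7 / (7`!)%:R))); last first.
    by rewrite ler_wpM2l ?exprn_ge0 ?(ltW K0) //; apply: le_trans h; rewrite lerDr.
  move: Cl; rewrite /C ler_pdivrMr ?mulr_gt0 ?exprn_gt0 // => Cl.
  rewrite mulrA ler_pdivlMr ?ltr0n ?fact_gt0 // exprMn.
  rewrite (_ : _ * _ = (64 * (7`!)%:R) * l%:R ^+ 6); last by ring.
  rewrite (_ : K ^+ 2 * _ = l%:R * (K ^+ 2 * ln 2 ^+ 7) * l%:R ^+ 6); last by ring.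
  by rewrite ler_wpM2r ?exprn_ge0.
apply: le_trans sq1 _; rewrite /rate ler_wpM2l ?(ltW K0) // ler_peMr ?sqrtr_ge0 //.
by rewrite -[leLHS](powRr0 (ln n%:R)) ler_powR // ltW // (lt_trans ltr01).
Qed.

End Asymptotics.

(** * Multiplicities in the bootstrap sample *)

Section Bootstrap.

Lemma card_ffun_const_on n (I : {set 'I_n}) (j : 'I_n) :
  #|[pred s : {ffun 'I_n -> 'I_n} | [forall i in I, s i == j]]| = (n ^ (n - #|I|))%N.
Proof.
pose F (i : 'I_n) : pred 'I_n := if i \in I then pred1 j else predT.
transitivity #|family F|.
  apply: eq_card => s; rewrite [LHS]inE; apply/forall_inP/familyP => [H i|H i iI].
    by rewrite /F; case: ifP => // /H.
  by have := H i; rewrite /F iI.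
rewrite card_family foldrE big_map big_enum /= -sum1_card.
transitivity (\prod_(i | i \notin I) n)%N.
  rewrite [RHS]big_mkcond; apply: eq_bigr => i _; rewrite /F.
  by case: (i \in I) => /=; [exact: card1|rewrite card_ord].
rewrite prod_nat_const; congr (n ^ _)%N.
have := cardC (mem I); rewrite card_ord => cC.
by rewrite sum1_card -[X in _ = (X - _)%N]cC addKn.
Qed.

(** Union bound over an observation, a set of [m] draws hitting it, and the [n ^ (n - m)] values of
    the other draws. The binomial coefficient times the factorial is a falling factorial, at most
    [n ^ m]. *)
Lemma card_mult_ge n m :
  (#|[pred s : {ffun 'I_n -> 'I_n} | [exists j, (m <= mult s j)%N]]| * m`! <= n * n ^ n)%N.
Proof.
have [nm|mn] := ltnP n m.
  rewrite eq_card0 // => s; rewrite !inE; apply/existsP => -[j].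
  by rewrite leqNgt (leq_ltn_trans (max_card _)) // card_ord.
pose B (q : 'I_n * {set 'I_n}) (s : {ffun 'I_n -> 'I_n}) :=
  (#|q.2| == m) && [forall i in q.2, s i == q.1].
apply: (@leq_trans ((\sum_(q : 'I_n * {set 'I_n}) \sum_s B q s) * m`!)%N).
  rewrite leq_mul2r exchange_big -sum1_card big_mkcond /=; apply/orP; right.
  apply: leq_sum => s _; rewrite inE; case: ifP => // /existsP[j].
  rewrite /mult => /card_geqP[t [ut st tj]].
  rewrite (bigD1 (j, [set i in t]%SET)) //= /B cardsE (card_uniqP ut) st eqxx /=.
  rewrite (_ : [forall _ in _, _]) //; apply/forall_inP => i; rewrite inE.
  by move/tj; rewrite inE.
rewrite -(pair_bigA _ (fun j I => \sum_s B (j, I) s)%N) /=.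
rewrite (eq_bigr (fun=> ('C(n, m) * n ^ (n - m))%N)) => [|j _]; last first.
  have := card_draws 'I_n m; rewrite card_ord => <-.
  rewrite -sum1_card big_distrl [RHS]big_mkcond /=; apply: eq_bigr => I _.
  rewrite inE /B /=.
  case: eqP => [Im|_]; last by rewrite big1.
  rewrite mul1n -Im -(card_ffun_const_on I j) -sum1_card [RHS]big_mkcond.
  by apply: eq_bigr => s _; rewrite inE; case: ifP.
rewrite sum_nat_const card_ord -mulnA leq_mul2l; apply/orP; right.
rewrite mulnAC bin_ffact -[X in (_ <= _ ^ X)%N](subnKC mn) expnD leq_mul2r.
apply/orP; right; rewrite ffact_prod -[X in (_ <= _ ^ X)%N](card_ord m).
by rewrite -prod_nat_const; apply: leq_prod => i _; exact: leq_subr.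
Qed.

Context d (Omega : measurableType d) (R : realType) (P : probability Omega R).

Lemma mult_tail n (b : Omega -> {ffun 'I_n -> 'I_n}) m :
  (forall s, measurable [set w | b w = s]) ->
  (forall s, P [set w | b w = s] = (((n ^ n)%:R : R)^-1)%:E) ->
  fine (P [set w | exists j, (m <= mult (b w) j)%N]) <= n%:R / (m`!)%:R.
Proof.
move=> mb Pb; pose B := [pred s : {ffun 'I_n -> 'I_n} | [exists j, (m <= mult s j)%N]].
have bigS : [set w | exists j, (m <= mult (b w) j)%N] =
    \bigcup_(s in [set` B]) [set w | b w = s].
  apply/seteqP; split=> w /=.
    by case=> j mj; exists (b w) => //=; rewrite inE; apply/existsP; exists j.
  by case=> s /=; rewrite inE => /existsP[j mj] ->; exists j.
apply: (@le_trans _ _ (\sum_s (s \in B)%:R * fine (P [set w | b w = s]))).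
  apply: prob_le_combination => //.
  - by rewrite bigS; apply: fin_bigcup_measurable.
  - move=> w; rewrite bigS => -[s /= sB bs].
    rewrite (bigD1 s) //= sB mul1r indicE mem_set // lerDl.
    by apply: sumr_ge0 => s' _; rewrite mulr_ge0.
under eq_bigr do rewrite Pb /=.
rewrite -mulr_suml -natr_sum -big_mkcond sum1_card.
have [n0|n0] := posnP (n ^ n)%N.
  by rewrite n0 invr0 mulr0.
rewrite ler_pdivlMr ?ltr0n ?fact_gt0 // mulrAC ler_pdivrMr ?ltr0n //.
by rewrite -!natrM ler_nat card_mult_ge.
Qed.

End Bootstrap.

(** * Shape of the leaves and their traces on the sample *)

Section Leaves.
Context (R : realType) (d : nat).

(** The bounding points may vary with the coordinate, so products of intervals qualify whichever of
    their faces are missing; there is no need to record which faces a leaf contains. *)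
Definition order_convex (S : set (xvec R d)) := forall p : xvec R d,
  (forall i, exists2 z, S z & tnth z i <= tnth p i) ->
  (forall i, exists2 z, S z & tnth p i <= tnth z i) -> S p.

Lemma box_order_convex (u v : 'I_d -> R) : order_convex (box u v).
Proof.
move=> p lo up i; have [z /(_ i)/andP[uz _] zp] := lo i.
have [z' /(_ i)/andP[_ z'v] pz'] := up i.
by rewrite (le_trans uz zp) (le_trans pz' z'v).
Qed.

Lemma leaf_order_convex (t : tree R d) (A : node R d) x :
  order_convex (region A) -> order_convex (leaf t A x).
Proof.
elim: t A => [|j z l IHl r IHr] A cA //=; case: ifP => _.
  apply: IHl => p lo up; split.
    by apply: cA => i; [have [q []] := lo i|have [q []] := up i]; exists q.
  by have [q [_ /= qz] pq] := up j; exact: le_trans pq qz.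
apply: IHr => p lo up; split.
  by apply: cA => i; [have [q []] := lo i|have [q []] := up i]; exists q.
by have [q [_ /= qz] pq] := lo j; exact: lt_le_trans qz pq.
Qed.

Definition box_trace n (D : n.-tuple (obs R d)) (ab : {ffun 'I_d -> 'I_n} * {ffun 'I_d -> 'I_n}) :
    {set 'I_n} :=
  [set j | [forall i, tnth (xs D (ab.1 i)) i <= tnth (xs D j) i
                   <= tnth (xs D (ab.2 i)) i]]%SET.

(* A leaf cuts the same points out of the sample as a closed box spanned by sample
   coordinates; hence there are at most n^(2d) such traces. *)
Lemma box_traceP n (D : n.-tuple (obs R d)) (S : set (xvec R d)) (j0 : 'I_n) :
  order_convex S -> S (xs D j0) ->
  exists ab, forall j, (j \in box_trace D ab) = (xs D j \in S).
Proof.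
move=> cS Sj0.
pose lo (i : 'I_d) := [arg min_(k < j0 | xs D k \in S) tnth (xs D k) i]%O.
pose up (i : 'I_d) := [arg max_(k > j0 | xs D k \in S) tnth (xs D k) i]%O.
have j0S : xs D j0 \in S by exact/mem_set.
exists ([ffun i => lo i], [ffun i => up i]) => j; rewrite inE.
apply/forallP/idP => /= [H|jS i]; last first.
  rewrite !ffunE /lo /up.
  case: arg_minP => // k kS kmin; case: arg_maxP => // k' k'S kmax.
  by apply/andP; split; [exact: kmin|exact: kmax].
apply/mem_set/cS => i; have := H i; rewrite !ffunE => /andP[lo_j j_up].
  exists (xs D (lo i)) => //; rewrite /lo.
  by case: arg_minP => // k kS _; exact/set_mem.
exists (xs D (up i)) => //; rewrite /up.
by case: arg_maxP => // k kS _; exact/set_mem.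
Qed.

End Leaves.

(** * Sigma-algebras generated by variables, and measurability of samples *)

Section SigmaOf.
Context d (Omega : measurableType d) (R : realType) (P : probability Omega R).

Section OneFunction.
Context dT (T : measurableType dT) (f : {mfun Omega >-> T}).

Lemma sigma_of_measurable : sigma_of f `<=` measurable.
Proof. by move=> _ [B mB <-]; exact: (measurable_funPT f). Qed.

Lemma sigma_of_setT : sigma_of f [set: Omega].
Proof. by exists setT => //; rewrite preimage_setT setTI. Qed.

Lemma sigma_of_setI : setI_closed (sigma_of f).
Proof.
move=> _ _ [B mB <-] [B' mB' <-]; exists (B `&` B'); first exact: measurableI.
by rewrite !setTI preimage_setI.
Qed.

Lemma sigma_of_preimage B : measurable B -> sigma_of f (f @^-1` B).
Proof. by move=> mB; exists B => //; rewrite setTI. Qed.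

Lemma others_measurable_fun (I : choiceType) (C : I -> set (set Omega)) i i0 :
  i != i0 -> C i = sigma_of f ->
  measurable_fun setT (f : g_sigma_algebraType (others C i0) -> T).
Proof.
move=> ii0 Ci _ B mB; rewrite setTI; apply: sub_sigma_algebra.
by exists i => //; rewrite Ci; exact: sigma_of_preimage.
Qed.

End OneFunction.

Section JointFamily.
Context d1 d2 (T1 : measurableType d1) (T2 : measurableType d2).
Context (I J : choiceType) (f : I -> {mfun Omega >-> T1}) (g : J -> {mfun Omega >-> T2}).
Let C := joint_family (fun i => f i : Omega -> _) (fun j => g j : Omega -> _).

Lemma joint_family_measurable i : C i `<=` measurable.
Proof. by case: i => i; exact: sigma_of_measurable. Qed.

Lemma joint_family_setT i : C i [set: Omega].
Proof. by case: i => i; exact: sigma_of_setT. Qed.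

Lemma joint_family_setI i : setI_closed (C i).
Proof. by case: i => i; exact: sigma_of_setI. Qed.

Lemma mutually_independent_left :
  mutually_independent P C -> mutually_independent P (fun i => sigma_of (f i)).
Proof.
move=> indep s E us sE.
pose E' (i : I + J) := if i is inl a then E a else setT.
have := indep (map inl s) E'; rewrite map_inj_uniq => [|? ? [] //].
rewrite big_map => <- //; last by move=> _ /mapP[i i_s ->]; exact: sE.
congr (P _); apply/seteqP; split=> w H.
  by move=> _ /= /mapP[i i_s ->]; exact: H.
by move=> i i_s; apply: (H (inl i)); exact: map_f.
Qed.

End JointFamily.
End SigmaOf.

Section Sample.
Context dO (Omega : measurableType dO) dS (S : measurableType dS).
Context (Z : nat -> {mfun Omega >-> S}).

Definition sample (n : nat) w : n.-tuple S := [tuple Z j w | j < n].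

(** [iota] stands for the identity, read from [Omega] with its own or with a coarser
    sigma-algebra. *)
Lemma sample_measurable dG (OG : measurableType dG) (iota : OG -> Omega) n :
  (forall j, measurable_fun setT (Z j \o iota)) -> measurable_fun setT (sample n \o iota).
Proof.
move=> mZ; apply/measurable_fun_tnthP => i.
rewrite (_ : _ \o _ = Z i \o iota); first exact: mZ.
by apply/funext => w /=; rewrite tnth_mktuple.
Qed.

End Sample.

(** * Deviations of the responses given the covariates *)

Section ConditionalLaw.
Context dO (Omega : measurableType dO) (R : realType) (P : probability Omega R).
Context (d : nat) (X : {RV P >-> (xvec R d)}) (Y : {RV P >-> R}).
Context (Q : R.-pker (xvec R d) ~> R) (condQ : conditional_law P X Y Q).
Context (Z : nat -> {RV P >-> (obs R d)}).
Hypothesis Z_copies : forall j, same_law P (Z j) (fun w => (X w, Y w)).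
Hypothesis indep : mutually_independent P (fun j => sigma_of (Z j)).

Let CZ (j : nat) := sigma_of (Z j).

Let independent_Z j W E : <<s others CZ j >> W -> measurable E ->
  P (W `&` Z j @^-1` E) = (P W * P (Z j @^-1` E))%E.
Proof.
move=> GW mE.
apply: (independent_of_others _ _ _ indep GW (sigma_of_preimage _ mE)) => i.
- exact: sigma_of_measurable.
- exact: sigma_of_setT.
- exact: sigma_of_setI.
Qed.

Let others_measurable j : others CZ j `<=` measurable.
Proof. by move=> W [i _ CW]; exact: sigma_of_measurable CW. Qed.

Context (B : set R) (p : R).
Hypothesis mB : measurable B.
Hypothesis p0 : 0 <= p.

Lemma kernel_le_measurable : measurable [set x | (Q x B <= p%:E)%E].
Proof.
rewrite -[X in measurable X]setTI.
apply: measurable_lee => //; exact: measurable_kernel.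
Qed.

(** Given the other observations and the covariate of observation [j], its response falls in [B]
    with probability at most [p] wherever [W] holds. Fubini freezes the other observations, and
    [condQ] treats the remaining pair. *)
Lemma conditional_step j (W : set (g_sigma_algebraType (others CZ j) * xvec R d)) :
  measurable W -> (forall w x, W (w, x) -> (Q x B <= p%:E)%E) ->
  fine (P ([set w | W (w, (Z j w).1)] `&` [set w | B (Z j w).2])) <=
    p * fine (P [set w | W (w, (Z j w).1)]).
Proof.
move=> mW WQ.
pose OG := g_sigma_algebraType (others CZ j).
pose W1 : set (OG * obs R d) := [set q | W (q.1, q.2.1)].
pose W2 : set (OG * obs R d) := W1 `&` [set q | B q.2.2].
have mW1 : measurable W1.
  rewrite -[X in measurable X]setTI.
  suff: measurable_fun setT (fun q : OG * obs R d => (q.1, q.2.1)) by exact.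
  apply: measurable_fun_pair => //; exact: measurableT_comp.
have mW2 : measurable W2.
  apply: measurableI => //; rewrite -[X in measurable X]setTI.
  suff: measurable_fun setT (fun q : OG * obs R d => q.2.2) by exact.
  exact: measurableT_comp.
have F1 := independent_fubini (@others_measurable j) (@independent_Z j) mW1.
have F2 := independent_fubini (@others_measurable j) (@independent_Z j) mW2.
have mZ1 : measurable [set w | W1 (w, Z j w)].
  exact: (preimage_graph_measurable (Z j) (@others_measurable j) mW1).
have mZ2 : measurable [set w | W2 (w, Z j w)].
  exact: (preimage_graph_measurable (Z j) (@others_measurable j) mW2).
change (fine (P [set w | W2 (w, Z j w)]) <= p * fine (P [set w | W1 (w, Z j w)])).
rewrite -lee_fin EFinM !fineK ?fin_num_measure // F1 F2.
have mS1 := section_prob_measurable_base P (Z j) (@others_measurable j) mW1.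
have mS2 := section_prob_measurable_base P (Z j) (@others_measurable j) mW2.
rewrite -ge0_integralZl ?lee_fin //.
apply: ge0_le_integral => //.
  exact: measurable_funeM.
(* With the other observations frozen at [w], both events are rectangles over [A], to which the
   identity defining [conditional_law] applies. *)
move=> w _; pose A : set (xvec R d) := xsection W w.
have mA : measurable A by exact: measurable_xsection.
have S1 : xsection W1 w = A `*` setT.
  by apply/seteqP; split=> -[x y]; rewrite /xsection /A /xsection /= !inE; tauto.
have S2 : xsection W2 w = A `*` B.
  by apply/seteqP; split=> -[x y]; rewrite /xsection /A /xsection /= !inE.
rewrite S1 S2 !Z_copies //; try exact: measurableX.
have -> : (fun w => (X w, Y w)) @^-1` (A `*` B) = X @^-1` A `&` Y @^-1` B by [].
have -> : (fun w => (X w, Y w)) @^-1` (A `*` setT) = X @^-1` A.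
  by apply/seteqP; split=> // w' [].
have mXA : measurable (X @^-1` A) by rewrite -[X in measurable X]setTI; exact: measurable_funPT.
rewrite condQ // -integral_cst //; apply: ge0_le_integral => //.
  apply: measurable_funTS.
  exact: (measurableT_comp (measurable_kernel Q _ mB) (measurable_funPT X)).
by move=> w'; rewrite /A /xsection /= inE => /WQ.
Qed.

Lemma coordinate_measurable n (i : 'I_n) (k : 'I_d) :
  measurable_fun setT (fun D : n.-tuple (obs R d) => tnth (xs D i) k).
Proof.
apply: (measurableT_comp (measurable_tnth k)).
apply: (measurableT_comp measurable_fst); exact: measurable_tnth.
Qed.

Lemma box_trace_measurable n ab (J : {set 'I_n}) :
  measurable [set D : n.-tuple (obs R d) | box_trace D ab = J].
Proof.
pose A j := \bigcap_(i in [set: 'I_d]) [set D : n.-tuple (obs R d) |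
  tnth (xs D (ab.1 i)) i <= tnth (xs D j) i <= tnth (xs D (ab.2 i)) i].
have mA j : measurable (A j).
  apply: fin_bigcap_measurable => // i _.
  rewrite (_ : mkset _ = [set D | tnth (xs D (ab.1 i)) i <= tnth (xs D j) i] `&`
    [set D | tnth (xs D j) i <= tnth (xs D (ab.2 i)) i]); last first.
    by apply/seteqP; split=> D /=; [move/andP|move=> H; apply/andP].
  apply: measurableI; rewrite -[X in measurable X]setTI;
    apply: measurable_fun_le => //; exact: coordinate_measurable.
rewrite (_ : mkset _ = \bigcap_(j in [set: 'I_n]) (if j \in J then A j else ~` A j)).
  by apply: fin_bigcap_measurable => // j _; case: ifP => // _; exact: measurableC.
have AE D j : A j D <-> j \in box_trace D ab.
  by rewrite inE; split=> [H|/forallP H]; [apply/forallP => i; exact: H|move=> i _; exact: H].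
apply/seteqP; split=> D /=.
  move=> <- j _; case: ifP => jD; first exact/AE.
  by move/AE; rewrite jD.
move=> H; apply/setP => j; have := H j I.
by case: ifP => jJ /AE //; move/negP/negbTE.
Qed.

(** This event depends on the covariates only. Since [J] is the exact trace, the events for one [ab]
    and different [J] are disjoint. *)
Definition sample_trace n ab (J : {set 'I_n}) : set Omega :=
  [set w | box_trace (sample Z n w) ab = J /\
           forall j, j \in J -> (Q (xs (sample Z n w) j) B <= p%:E)%E].

Let trace_set n ab (J J' : {set 'I_n}) : set (n.-tuple (obs R d)) :=
  [set D | box_trace D ab = J] `&`
  (\bigcap_(j in [set` J]) [set D | (Q (xs D j) B <= p%:E)%E]) `&`
  (\bigcap_(j in [set` J']) [set D | B (ys D j)]).

Let trace_set_measurable n ab (J J' : {set 'I_n}) : measurable (trace_set ab J J').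
Proof.
apply: measurableI; first apply: measurableI.
- exact: box_trace_measurable.
- apply: fin_bigcap_measurable => // j _; rewrite -[X in measurable X]setTI.
  have : measurable_fun setT (fun D : n.-tuple (obs R d) => xs D j).
    apply: (measurableT_comp measurable_fst); exact: measurable_tnth.
  by move/(_ measurableT _ kernel_le_measurable).
- apply: fin_bigcap_measurable => // j _; rewrite -[X in measurable X]setTI.
  have : measurable_fun setT (fun D : n.-tuple (obs R d) => ys D j).
    apply: (measurableT_comp measurable_snd); exact: measurable_tnth.
  by move/(_ measurableT _ mB).
Qed.

Let hit n (j : 'I_n) : set Omega := [set w | B (Z j w).2].

Let hit_measurable n (j : 'I_n) : measurable (hit j).
Proof.
rewrite -[X in measurable X]setTI.
have : measurable_fun setT (fun w => (Z j w).2).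
  apply: (measurableT_comp measurable_snd); exact: measurable_funPT.
by move/(_ measurableT _ mB).
Qed.

Let trace_setE n ab (J J' : {set 'I_n}) :
  sample_trace ab J `&` \bigcap_(j in [set` J']) hit j =
  sample Z n @^-1` trace_set ab J J'.
Proof.
apply/seteqP; split=> w.
  move=> [[tr QJ] hJ]; split; first by split.
  by move=> j /hJ; rewrite /= /ys tnth_mktuple.
move=> [[tr QJ] hJ]; split; first by split.
by move=> j /hJ; rewrite /= /ys tnth_mktuple.
Qed.

Let sample_trace_measurable n ab (J : {set 'I_n}) : measurable (sample_trace ab J).
Proof.
have -> : sample_trace ab J = sample Z n @^-1` trace_set ab J finset.set0.
  rewrite -trace_setE; apply/seteqP; split=> w; last by case.
  by move=> H; split=> // j /=; rewrite inE.
rewrite -[X in measurable X]setTI.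
have : measurable_fun setT (sample Z n).
  by apply: (@sample_measurable _ _ _ _ Z _ Omega id) => j; exact: measurable_funPT.
by move/(_ measurableT _ (@trace_set_measurable _ _ _ _)).
Qed.

Let trace_step n ab (J J' : {set 'I_n}) i : i \in J -> i \notin J' ->
  fine (P (sample_trace ab J `&` \bigcap_(j in [set` J']) hit j `&` hit i)) <=
    p * fine (P (sample_trace ab J `&` \bigcap_(j in [set` J']) hit j)).
Proof.
move=> iJ iJ'.
pose OG := g_sigma_algebraType (others CZ i).
(* The event does not involve Y^i, so the i-th response may be replaced by 0. *)
pose psi (q : OG * xvec R d) : n.-tuple (obs R d) :=
  [tuple if k == i then (q.2, 0) else Z k q.1 | k < n].
have mpsi : measurable_fun setT psi.
  apply/measurable_fun_tnthP => k.
  have [ki|ki] := eqVneq k i.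
    rewrite (_ : _ \o _ = fun q : OG * xvec R d => (q.2, 0)); last first.
      by apply/funext => q /=; rewrite tnth_mktuple ki eqxx.
    exact: measurable_fun_pair.
  rewrite (_ : _ \o _ = (Z k : OG -> obs R d) \o fst); last first.
    by apply/funext => q /=; rewrite tnth_mktuple (negbTE ki).
  apply: measurableT_comp => //.
  by apply: (others_measurable_fun (i := nat_of_ord k)).
pose W := psi @^-1` trace_set ab J J'.
have mW : measurable W.
  by have := mpsi measurableT _ (@trace_set_measurable n ab J J'); rewrite setTI.
have xspsi w k : xs (psi (w, (Z i w).1)) k = xs (sample Z n w) k.
  by rewrite /xs !tnth_mktuple; case: eqP => [->|].
have WE : [set w | W (w, (Z i w).1)] =
    sample_trace ab J `&` \bigcap_(j in [set` J']) hit j.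
  have trE w : box_trace (psi (w, (Z i w).1)) ab = box_trace (sample Z n w) ab.
    by apply/setP => k; rewrite !inE; apply: eq_forallb => l; rewrite !xspsi.
  have ysE w k : k \in J' -> ys (psi (w, (Z i w).1)) k = ys (sample Z n w) k.
    move=> kJ'; rewrite /ys !tnth_mktuple; case: eqP => // ki.
    by move: iJ'; rewrite -ki kJ'.
  rewrite trace_setE; apply/seteqP; split=> w -[[tr QJ] hJ]; split=> //.
  - split; first by rewrite /= -trE.
    by move=> k /QJ; rewrite /= xspsi.
  - by move=> k kJ'; have := hJ k kJ'; rewrite /= ysE.
  - split; first by rewrite /= trE.
    by move=> k /QJ; rewrite /= xspsi.
  - by move=> k kJ'; have := hJ k kJ'; rewrite /= ysE.
rewrite -WE; apply: conditional_step => // w x [[_ QJ] _].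
by have := QJ i iJ; rewrite /= /xs tnth_mktuple eqxx.
Qed.

Lemma trace_chernoff n ab (J : {set 'I_n}) (eps : R) : p <= 1 -> 0 <= eps <= 1 ->
  fine (P (sample_trace ab J `&`
    [set w | (p + eps) * #|J|%:R <= \sum_(j in J) \1_B (Z j w).2]))
  <= expR (- (eps ^+ 2 / 8)) ^+ #|J| * fine (P (sample_trace ab J)).
Proof.
move=> p1 eps01; apply: (@chernoff_meets _ _ _ _ _ (@hit n)) => //.
  by rewrite p0.
by move=> J' J'J; apply: prob_meet_le => // J'' i sJ iJ; exact/trace_step/(fintype.subsetP J'J).
Qed.

(** The bound holds for all boxes [ab] at once, so it may later be applied to the box of a leaf
    chosen from the data. *)
Lemma large_trace_frequency_ae (eps : R) : p <= 1 -> 0 < eps <= 1 ->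
  {ae P, forall w, \forall n \near \oo, forall ab,
    let J := box_trace (sample Z n w) ab in
    (log2 n ^ 2 <= #|J|)%N ->
    (forall j, j \in J -> (Q (xs (sample Z n w) j) B <= p%:E)%E) ->
    \sum_(j in J) \1_B (Z j w).2 < (p + eps) * #|J|%:R}.
Proof.
move=> p1 /andP[e0 e1].
pose idx n := ({ffun 'I_d -> 'I_n} * {ffun 'I_d -> 'I_n} * {set 'I_n})%type.
pose A n (q : idx n) := sample_trace q.1 q.2 `&`
  [set w | (p + eps) * #|q.2|%:R <= \sum_(j in q.2) (\1_B (Z j w).2 : R)].
pose F n := \bigcup_(q in [set` [pred q : idx n | (log2 n ^ 2 <= #|q.2|)%N]]) A n q.
pose rho : R := expR (- (eps ^+ 2 / 8)).
have rho1 : 0 < rho < 1.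
  by rewrite expR_gt0 /= -[ltRHS]expR0 ltr_expR oppr_lt0 divr_gt0 ?exprn_gt0.
have mA n q : measurable (A n q).
  apply: measurableI; first exact: sample_trace_measurable.
  rewrite -[X in measurable X]setTI; apply: measurable_fun_le => //.
  under eq_fun do rewrite big_mkcond.
  apply: measurable_sum => j; case: (j \in q.2); last exact: measurable_cst.
  exact: (measurable_indic (@hit_measurable n j)).
have mF n : measurable (F n) by apply: fin_bigcup_measurable.
have FP n : fine (P (F n)) <= (n ^ (d + d))%:R * rho ^+ (log2 n ^ 2).
  apply: (@le_trans _ _ (\sum_(q : idx n) (log2 n ^ 2 <= #|q.2|)%N%:R * fine (P (A n q)))).
    apply: prob_le_combination => // w [q /= + Aq]; rewrite inE => Lq.
    rewrite (bigD1 q) //= Lq mul1r indicE mem_set // lerDl.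
    by apply: sumr_ge0 => q' _; rewrite mulr_ge0.
  apply: (@le_trans _ _ (\sum_(q : idx n) rho ^+ (log2 n ^ 2) *
      fine (P (sample_trace q.1 q.2)))).
    apply: ler_sum => q _; have [Lq|_] := boolP (log2 n ^ 2 <= #|q.2|)%N; last first.
      by rewrite mul0r mulr_ge0 ?exprn_ge0 ?expR_ge0 ?fine_ge0.
    rewrite mul1r; apply: le_trans (trace_chernoff _ _ _ _) _ => //.
      by rewrite e1 (ltW e0).
    apply: ler_wpM2r; first exact: fine_ge0.
    by case/andP: rho1 => /ltW r0 /ltW r1; apply: ler_wiXn2l.
  rewrite -mulr_sumr mulrC ler_wpM2r ?exprn_ge0 ?expR_ge0 //.
  rewrite -(pair_bigA _ (fun ab J => fine (P (sample_trace ab J)))) /=.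
  (* For fixed [ab] the disjoint events contribute at most 1 in total: the union bound pays for the
     boxes, not for the subsets of the sample. *)
  apply: (@le_trans _ _ (\sum_(ab : {ffun 'I_d -> 'I_n} * {ffun 'I_d -> 'I_n}) 1)).
    apply: ler_sum => ab _; apply: sum_disjoint_prob_le1 => [J|J J' w [<- _] [<- _] //].
    exact: sample_trace_measurable.
  by rewrite sumr_const card_prod card_ffun !card_ord expnD.
apply: filterS (borel_cantelli_ae (b := fun n => ((n.+1)%:R ^+ 2)^-1) mF _
  (@inv_square_series_le R) _).
- move=> w; apply: filterS => n nF ab LJ QJ; rewrite ltNge; apply/negP => Hge.
  apply: nF; exists (ab, box_trace (sample Z n w) ab); first by rewrite /= inE.
  by split; first split.
- by move=> n; rewrite invr_ge0 exprn_ge0.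
- apply: filterS (log2_exp_small (d + d) rho1) => n; exact: le_trans (FP n).
Qed.

End ConditionalLaw.

(** * The forest estimate as an average of leaf means *)

Section LeafMean.
Context (R : realType) (d : nat).

(** On a leaf without observations the value is 0, as [0^-1 = 0]; hence the bounds 0 and 1 and the
    monotonicity in [y] hold for every [S]. *)
Definition leaf_mean n (D : n.-tuple (obs R d)) (S : set (xvec R d)) (y : R) : R :=
  (\sum_(j < n | xs D j \in S) (ys D j <= y)%R%:R) / (No D S)%:R.

Lemma forest_cdf_mean n (D : n.-tuple (obs R d)) k L y :
  forest_cdf D k L y = k%:R^-1 * \sum_(l < k) leaf_mean D (L l) y.
Proof.
rewrite /forest_cdf; under eq_bigr do rewrite -mulrA.
rewrite -mulr_sumr; congr (_ * _).
under eq_bigr do rewrite mulr_suml.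
rewrite exchange_big /=; apply: eq_bigr => l _.
rewrite /leaf_mean mulr_suml [RHS]big_mkcond; apply: eq_bigr => j _.
by case: (xs D j \in L l); rewrite ?mul0r // mul1r mulrC.
Qed.

Lemma leaf_mean_ge0 n (D : n.-tuple (obs R d)) S y : 0 <= leaf_mean D S y.
Proof. by rewrite divr_ge0 // sumr_ge0. Qed.

Lemma NoE n (D : n.-tuple (obs R d)) S : No D S = #|[set j | xs D j \in S]%SET|.
Proof. by rewrite cardsE. Qed.

Lemma leaf_mean_le1 n (D : n.-tuple (obs R d)) S y : leaf_mean D S y <= 1.
Proof.
have [N0|N0] := posnP (No D S); first by rewrite /leaf_mean N0 invr0 mulr0.
rewrite ler_pdivrMr ?ltr0n // mul1r /No -sum1_card natr_sum.
by apply: ler_sum => j _; case: (ys D j <= y)%R.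
Qed.

Lemma leaf_mean_homo n (D : n.-tuple (obs R d)) S :
  {homo leaf_mean D S : y y' / y <= y'}.
Proof.
move=> y y' yy'; rewrite ler_wpM2r ?invr_ge0 //; apply: ler_sum => j _.
by case: (leP (ys D j) y) => // jy; rewrite (le_trans jy yy').
Qed.

Lemma forest_cdf_01 n (D : n.-tuple (obs R d)) k L y : (0 < k)%N ->
  0 <= forest_cdf D k L y <= 1.
Proof.
move=> k0; have k0R : 0 < k%:R :> R by rewrite ltr0n.
rewrite forest_cdf_mean; apply/andP; split.
  by rewrite mulr_ge0 ?invr_ge0 ?sumr_ge0 // => l _; exact: leaf_mean_ge0.
rewrite ler_pdivrMl // mulr1 -[X in _ <= X%:R](card_ord k) -sum1_card natr_sum.
by apply: ler_sum => l _; exact: leaf_mean_le1.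
Qed.

Lemma forest_cdf_homo n (D : n.-tuple (obs R d)) k L :
  {homo forest_cdf D k L : y y' / y <= y'}.
Proof.
move=> y y' yy'; rewrite !forest_cdf_mean ler_wpM2l ?invr_ge0 //.
by apply: ler_sum => l _; exact: leaf_mean_homo.
Qed.

End LeafMean.

(** * The conditional distribution function *)

Section KernelProbability.
Context dT (T : measurableType dT) (R : realType) (Q : R.-pker T ~> R).

(** [Q x] repackaged as a probability measure, so that complements and monotone limits can be
    taken. *)
Definition kernel_prob (x : T) : set (measurableTypeR R) -> \bar R := Q x.

HB.instance Definition _ x := isMeasure.Build _ _ _ (kernel_prob x)
  (measure0 (Q x)) (measure_ge0 (Q x)) (@measure_semi_sigma_additive _ _ _ (Q x)).

HB.instance Definition _ x := Measure_isProbability.Build _ _ _ (kernel_prob x)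
  (prob_kernel x).

Lemma cond_cdfE y x : Q x `]-oo, y]%classic = (cond_cdf Q y x)%:E.
Proof.
rewrite /cond_cdf fineK //.
have mI : measurable (`]-oo, y]%classic : set (measurableTypeR R)).
  exact: measurable_itv.
exact: (fin_num_measure (kernel_prob x) _ mI).
Qed.

Lemma cond_cdf_ge0 y x : 0 <= cond_cdf Q y x.
Proof. exact: fine_ge0. Qed.

Lemma cond_cdf_le1 y x : cond_cdf Q y x <= 1.
Proof.
rewrite -lee_fin -cond_cdfE.
have mI : measurable (`]-oo, y]%classic : set (measurableTypeR R)).
  exact: measurable_itv.
exact: (probability_le1 (kernel_prob x) mI).
Qed.

Lemma kernel_setC_itv y x :
  Q x (~` `]-oo, y]%classic) = (1 - cond_cdf Q y x)%:E.
Proof.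
have mI : measurable (`]-oo, y]%classic : set (measurableTypeR R)).
  exact: measurable_itv.
rewrite EFinB -cond_cdfE; exact: (probability_setC (kernel_prob x) mI).
Qed.

(** Continuity from above along half-lines with empty intersection. With [cond_cdf_large] it
    provides the limits at infinity on which the existence of quantiles rests. *)
Lemma cond_cdf_small x (e : R) : 0 < e -> exists y, cond_cdf Q y x < e.
Proof.
move=> e0; pose F n : set (measurableTypeR R) := `]-oo, - n%:R]%classic.
have mF n : measurable (F n) by exact: measurable_itv.
have : kernel_prob x (F n) @[n --> \oo] --> kernel_prob x (\bigcap_n F n).
  apply: nonincreasing_cvg_mu => //.
  - by rewrite (le_lt_trans (probability_le1 _ _)) ?ltry.
  - exact: bigcap_measurable.
  - move=> m n mn; apply/subsetPset => z; rewrite /F /= !in_itv /= => /le_trans; apply.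
    by rewrite lerN2 ler_nat.
have -> : \bigcap_n F n = set0.
  rewrite -subset0 => z /(_ (Num.truncn (- z)).+1 I).
  by rewrite /F /= in_itv /= leNgt => /negP; apply; rewrite ltrNl truncnS_gt.
rewrite measure0 => /fine_cvg /cvgr_lt /(_ _ e0) [n _ /(_ n (leqnn n)) /= H].
by exists (- n%:R).
Qed.

Lemma cond_cdf_large x (e : R) : 0 < e -> exists y, 1 - e < cond_cdf Q y x.
Proof.
move=> e0; pose F n : set (measurableTypeR R) := `]-oo, n%:R]%classic.
have mF n : measurable (F n) by exact: measurable_itv.
have : kernel_prob x (F n) @[n --> \oo] --> kernel_prob x (\bigcup_n F n).
  apply: nondecreasing_cvg_mu => //; first exact: bigcup_measurable.
  move=> m n mn; apply/subsetPset => z; rewrite /F /= !in_itv /= => /le_trans; apply.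
  by rewrite ler_nat.
have -> : \bigcup_n F n = setT.
  rewrite -subTset => z _; exists (Num.truncn z).+1 => //.
  by rewrite /F /= in_itv /= ltW // truncnS_gt.
rewrite probability_setT => /fine_cvg /cvgr_gt H.
have e1 : 1 - e < 1 by rewrite gtrBl.
by have [n _ /(_ n (leqnn n)) /= Hn] := H _ e1; exists n%:R.
Qed.

End KernelProbability.

(** * The mean of a single leaf *)

Section LeafMeanConvergence.
Context dO (Omega : measurableType dO) (R : realType) (P : probability Omega R).
Context (d : nat) (X : {RV P >-> (xvec R d)}) (Y : {RV P >-> R}).
Context (Q : R.-pker (xvec R d) ~> R) (condQ : conditional_law P X Y Q).
Context (Z : nat -> {RV P >-> (obs R d)}).
Hypothesis Z_copies : forall j, same_law P (Z j) (fun w => (X w, Y w)).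
Hypothesis indep : mutually_independent P (fun j => sigma_of (Z j)).

(** One [eps] is the variation of the conditional distribution function over the leaf, the other the
    deviation of the frequency. The upper bound comes from the half-line, the lower one from its
    complement. *)
Lemma leaf_mean_close_ae (y c eps : R) : 0 <= c <= 1 -> 0 < eps <= 1 ->
  {ae P, forall w, \forall n \near \oo, forall S : set (xvec R d),
    order_convex S -> (log2 n ^ 2 <= No (sample Z n w) S)%N ->
    (forall j, xs (sample Z n w) j \in S ->
      `|cond_cdf Q y (xs (sample Z n w) j) - c| <= eps) ->
    `|leaf_mean (sample Z n w) S y - c| <= 2 * eps}.
Proof.
move=> /andP[c0 c1] eps01; have /andP[e0 e1] := eps01.
pose B : set R := `]-oo, y]%classic.
have mB : measurable B by exact: measurable_itv.
(* The caps at 1 meet the condition [p <= 1] of the Chernoff bound. *)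
pose p1 : R := Num.min 1 (c + eps); pose p2 : R := Num.min 1 (1 - c + eps).
have p10 : 0 <= p1 by rewrite le_min ler01 addr_ge0 // ltW.
have p20 : 0 <= p2 by rewrite le_min ler01 addr_ge0 ?subr_ge0 // ltW.
have p11 : p1 <= 1 by rewrite ge_min lexx.
have p21 : p2 <= 1 by rewrite ge_min lexx.
have := large_trace_frequency_ae condQ Z_copies indep mB p10 p11 eps01.
have := large_trace_frequency_ae condQ Z_copies indep (measurableC mB) p20 p21 eps01.
apply: filterS2 => w; apply: filterS2 => n up lo S cS LS FS.
set D := sample Z n w in LS FS *.
have L0 : (0 < log2 n ^ 2)%N by rewrite expn_gt0.
have N0 : (0 < No D S)%N by exact: leq_trans LS.
have [j0 j0S] : exists j, xs D j \in S by exact/card_gt0P.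
have [ab abE] := box_traceP cS (set_mem j0S).
have JE : box_trace D ab = [set j | xs D j \in S]%SET.
  by apply/setP => j; rewrite abE inE.
have cardJ : #|box_trace D ab| = No D S by rewrite JE NoE.
have yB j : (\1_B (Z (nat_of_ord j) w).2 : R) = (ys D j <= y)%R%:R.
  by rewrite indicE /ys tnth_mktuple /B; congr (_%:R); rewrite mem_setE in_itv.
pose s : R := \sum_(j in box_trace D ab) (ys D j <= y)%R%:R.
have sE : leaf_mean D S y * (No D S)%:R = s.
  rewrite /leaf_mean divfK ?pnatr_eq0 -?lt0n // /s JE.
  by apply: eq_bigl => j; rewrite inE.
have m0 : 0 < (No D S)%:R :> R by rewrite ltr0n.
have Hup : s < (p1 + eps) * (No D S)%:R.
  rewrite -cardJ /s; under eq_bigr do rewrite -yB.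
  apply: lo; first by rewrite cardJ.
  move=> j; rewrite abE => /FS; rewrite cond_cdfE lee_fin ler_norml => /andP[_ h].
  by rewrite le_min cond_cdf_le1 /=; lra.
have Hlo : (No D S)%:R - s < (p2 + eps) * (No D S)%:R.
  have -> : (No D S)%:R - s =
      \sum_(j in box_trace D ab) (\1_(~` B) (Z (nat_of_ord j) w).2 : R).
    rewrite -cardJ /s -sum1_card natr_sum -sumrB; apply: eq_bigr => j _.
    by rewrite -yB !indicE in_setC; case: (_ \in B); rewrite ?subrr ?subr0.
  rewrite -cardJ; apply: up; first by rewrite cardJ.
  move=> j; rewrite abE => /FS; rewrite ler_norml => /andP[h _].
  rewrite kernel_setC_itv lee_fin le_min.
  by rewrite gerBl cond_cdf_ge0 /=; lra.
have p1e : p1 <= c + eps by rewrite ge_min lexx orbT.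
have p2e : p2 <= 1 - c + eps by rewrite ge_min lexx orbT.
rewrite ler_norml; apply/andP; split.
  rewrite -(ler_pM2r m0) mulrBl sE; nra.
rewrite -(ler_pM2r m0) mulrBl sE; nra.
Qed.

End LeafMeanConvergence.

(** * Conditioning on the data and on the other labels *)

Section Trees.
Context dO (Omega : measurableType dO) (R : realType) (P : probability Omega R).
Context dS (S : measurableType dS) (Z : nat -> {mfun Omega >-> S}).
Context dT (T : measurableType dT).

Section IndependentLabels.
Context (J : choiceType) (Th : J -> {mfun Omega >-> T}).
Let C := joint_family (fun j : nat => Z j : Omega -> _) (fun l => Th l : Omega -> _).
Hypothesis indep : mutually_independent P C.

Let others_measurable i : others C i `<=` measurable.
Proof. by move=> W [j _ CW]; exact: joint_family_measurable CW. Qed.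

Let label_indep l W A : <<s others C (inr l) >> W -> measurable A ->
  P (W `&` Th l @^-1` A) = (P W * P (Th l @^-1` A))%E.
Proof.
move=> GW mA.
have Cl : C (inr l) (Th l @^-1` A) by exact: sigma_of_preimage.
apply: (independent_of_others _ _ _ indep GW Cl) => i.
- exact: joint_family_measurable.
- exact: joint_family_setT.
- exact: joint_family_setI.
Qed.

Definition sample_sigma : set (set Omega) := \bigcup_(j in [set: nat]) sigma_of (Z j).

(** The right-hand side involves [Th l] only through its law, which allows one label to be exchanged
    for another. *)
Lemma sample_sigma_fubini l (B : set (g_sigma_algebraType sample_sigma * T)) :
  measurable B ->
  P [set w | B (w, Th l w)] = (\int[P]_w P (Th l @^-1` xsection B w))%E.
Proof.
move=> mB; apply: independent_fubini mB.
  by move=> W [j _ ZW]; exact: sigma_of_measurable ZW.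
move=> W A sW mA; apply: label_indep => //.
apply: smallest_sub sW; first exact: smallest_sigma_algebra.
by move=> V [j _ ZV]; apply: sub_sigma_algebra; exists (inl j).
Qed.

(** Counterpart of [conditional_step] with labels instead of responses: [W] is known without label
    [l], and on it the conditional probability of [B] is at most [p]. *)
Lemma label_step l (W : set Omega) (B : set (g_sigma_algebraType (others C (inr l)) * T))
    (p : R) : 0 <= p -> measurable B -> <<s others C (inr l) >> W ->
  (forall w, W w -> (P (Th l @^-1` xsection B w) <= p%:E)%E) ->
  fine (P (W `&` [set w | B (w, Th l w)])) <= p * fine (P W).
Proof.
move=> p0 mB GW WB.
pose G := others C (inr l).
(* The section of [B'] is empty off [W], where no bound is assumed. *)
pose B' : set (g_sigma_algebraType G * T) := (W `*` setT) `&` B.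
have mB' : measurable B' by apply: measurableI => //; exact: measurableX.
have mW : measurable W by exact: sigma_sub_measurable GW.
have mBw : measurable [set w | B (w, Th l w)].
  exact: (preimage_graph_measurable (Th l) (@others_measurable _) mB).
rewrite -lee_fin EFinM !fineK ?fin_num_measure //; last exact: measurableI.
have -> : W `&` [set w | B (w, Th l w)] = [set w | B' (w, Th l w)].
  by apply/seteqP; split=> w; [case=> Ww Bw; split|case=> -[]].
rewrite (independent_fubini (@others_measurable _) (@label_indep l) mB').
rewrite -[in leRHS](setIT W) -integral_indic // -ge0_integralZl ?lee_fin //; last first.
  exact/measurable_EFinP.
apply: ge0_le_integral => //.
- exact: (section_prob_measurable_base P (Th l) (@others_measurable _) mB').
- by apply: measurable_funeM; exact/measurable_EFinP.
- move=> w _; rewrite indicE; case: (boolP (w \in W)) => [/set_mem Ww|/negP nW].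
    rewrite mule1; apply: le_trans (WB _ Ww).
    rewrite le_measure ?inE //; try by
      rewrite -[X in measurable X]setTI; apply: measurable_funPT => //; exact: measurable_xsection.
    by apply: preimage_subset => t; rewrite /xsection /= !inE => -[].
  rewrite mule0 (_ : Th l @^-1` _ = set0) ?measure0 //.
  rewrite -subset0 => t; rewrite /xsection /= inE => -[[Ww _] _].
  by apply: nW; exact/mem_set.
Qed.

End IndependentLabels.
End Trees.

(** * The proportion of bad labels among many *)

Section BadLabels.
Context dO (Omega : measurableType dO) (R : realType) (P : probability Omega R).
Context dS (S : measurableType dS) (Z : nat -> {mfun Omega >-> S}).
Context dT (T : measurableType dT).
Context (A : forall n, set (T * n.-tuple S)) (mA : forall n, measurable (A n)).

(** The label is left free, so that the section at [w] consists of the labels that are bad at some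
    time from [N] on for the data at [w]. *)
Definition bad_from N : set (Omega * T) :=
  \bigcup_(n in [set n | (N <= n)%N]) [set q | A (q.2, sample Z n q.1)].

Lemma bad_from_measurable (G : set (set Omega)) N :
  (forall j, measurable_fun setT (Z j : g_sigma_algebraType G -> S)) ->
  measurable (bad_from N : set (g_sigma_algebraType G * T)).
Proof.
move=> mZ; apply: bigcup_measurable => n _.
have : measurable_fun setT
    (fun q : g_sigma_algebraType G * T => (q.2, sample Z n q.1)).
  apply: measurable_fun_pair => //.
  apply: (measurableT_comp _ measurable_fst).
  exact: (@sample_measurable _ _ _ _ Z _ (g_sigma_algebraType G) id).
by move=> /(_ measurableT _ (@mA n)); rewrite setTI.
Qed.

Lemma sample_sigma_measurable_fun j :
  measurable_fun setT (Z j : g_sigma_algebraType (sample_sigma Z) -> S).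
Proof.
move=> _ B mB; rewrite setTI; apply: sub_sigma_algebra.
by exists j => //; exact: sigma_of_preimage.
Qed.

Let bad_from_sample N := @bad_from_measurable (sample_sigma Z) N sample_sigma_measurable_fun.

Lemma bad_from_law (J J' : choiceType) (Th : J -> {mfun Omega >-> T})
    (Th' : J' -> {mfun Omega >-> T}) l l' :
  mutually_independent P (joint_family (fun j : nat => Z j : Omega -> _)
    (fun l => Th l : Omega -> _)) ->
  mutually_independent P (joint_family (fun j : nat => Z j : Omega -> _)
    (fun l => Th' l : Omega -> _)) ->
  same_law P (Th l) (Th' l') ->
  forall N, P [set w | bad_from N (w, Th l w)] = P [set w | bad_from N (w, Th' l' w)].
Proof.
move=> indep indep' law N.
rewrite (sample_sigma_fubini indep l (bad_from_sample N)).
rewrite (sample_sigma_fubini indep' l' (bad_from_sample N)).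
by apply: eq_integral => w _; apply: law; exact: measurable_xsection.
Qed.

Lemma bad_set_measurable (Th : {mfun Omega >-> T}) N :
  measurable [set w | bad_from N (w, Th w)].
Proof.
rewrite (_ : mkset _ = \bigcup_(n in [set n | (N <= n)%N])
    [set w | A (Th w, sample Z n w)]); last by apply/seteqP; split.
apply: bigcup_measurable => n _.
have : measurable_fun setT (fun w => (Th w, sample Z n w)).
  apply: measurable_fun_pair; first exact: measurable_funPT.
  by apply: (@sample_measurable _ _ _ _ Z _ Omega id) => j; exact: measurable_funPT.
by move=> /(_ measurableT _ (@mA n)); rewrite setTI.
Qed.

Lemma bad_from_anti (q : Omega * T) M N : (M <= N)%N -> bad_from N q -> bad_from M q.
Proof. by move=> MN [n /= Nn An]; exists n => //=; exact: leq_trans Nn. Qed.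

Definition eventually_good (Th : Omega -> T) :=
  {ae P, forall w, \forall n \near \oo, ~ A (Th w, sample Z n w)}.

(** These events decrease to that of being bad infinitely often. An almost sure property is thus
    expressed by probabilities, which depend on laws only. *)
Lemma eventually_goodP (Th : {mfun Omega >-> T}) :
  eventually_good Th <->
  P [set w | bad_from N (w, Th w)] @[N --> \oo] --> 0%E.
Proof.
pose F N := [set w | bad_from N (w, Th w)].
have mF N : measurable (F N) by exact: bad_set_measurable.
have mFi : measurable (\bigcap_N F N) by exact: bigcap_measurable.
have cvgF : P (F N) @[N --> \oo] --> P (\bigcap_N F N).
  apply: nonincreasing_cvg_mu => //.
    by rewrite (le_lt_trans (probability_le1 _ _)) ?ltry.
  by move=> M N MN; apply/subsetPset => w; exact: bad_from_anti.
have FE w : (\forall n \near \oo, ~ A (Th w, sample Z n w)) <-> ~ (\bigcap_N F N) w.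
  split=> [[N _ HN] /(_ N I) [n /= Nn]|]; first exact: HN.
  move=> nF; have [N nFN] : exists N, ~ F N w.
    by apply: contra_notP nF => H N _; apply: contrapT => nFN; apply: H; exists N.
  by exists N => // n Nn An; apply: nFN; exists n.
split=> [[K [mK PK sK]]|F0].
  suff <- : P (\bigcap_N F N) = 0%E by exact: cvgF.
  apply: measure_negligible => //; exists K; split=> // w Fw.
  by apply: sK => /= /FE.
exists (\bigcap_N F N); split=> //.
  by apply: cvg_unique cvgF F0.
by move=> w /= H; apply: contrapT => nF; apply: H; apply/FE.
Qed.

(** Needed because hypothesis (B) concerns the generic [Theta] and (A) its copies. *)
Lemma eventually_good_transfer (J J' : choiceType) (Th : J -> {mfun Omega >-> T})
    (Th' : J' -> {mfun Omega >-> T}) l l' :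
  mutually_independent P (joint_family (fun j : nat => Z j : Omega -> _)
    (fun l => Th l : Omega -> _)) ->
  mutually_independent P (joint_family (fun j : nat => Z j : Omega -> _)
    (fun l => Th' l : Omega -> _)) ->
  same_law P (Th l) (Th' l') -> eventually_good (Th l) -> eventually_good (Th' l').
Proof.
move=> indep indep' law /eventually_goodP H; apply/eventually_goodP.
by under eq_fun do rewrite -(bad_from_law indep indep' law).
Qed.

(* By Fubini, bad_prob N w is the conditional probability, given the sample, that a
   label is bad at some time n >= N; given the sample the labels are independent. *)
Section ManyLabels.
Context (Th : nat -> {mfun Omega >-> T}).
Let C := joint_family (fun j : nat => Z j : Omega -> _) (fun l => Th l : Omega -> _).
Hypothesis indep : mutually_independent P C.
Hypothesis same : forall l, same_law P (Th l) (Th 0%N).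
Context (eps : R).
Hypothesis eps01 : 0 < eps <= 1.

Let bad_prob N w := P (Th 0%N @^-1` xsection (bad_from N) w).

Let good N : set Omega := [set w | (bad_prob N w <= eps%:E)%E].

Let bad N l : set Omega := [set w | bad_from N (w, Th l w)].

Let others_measurable i : others C i `<=` measurable.
Proof. by move=> W [j _ CW]; exact: joint_family_measurable CW. Qed.

Let sample_others l j :
  measurable_fun setT (Z j : g_sigma_algebraType (others C (inr l)) -> S).
Proof. exact: (others_measurable_fun (i := inl j)). Qed.

Let bad_from_others N l := @bad_from_measurable (others C (inr l)) N (@sample_others l).

Let bad_measurable N l : measurable (bad N l).
Proof. exact: bad_set_measurable. Qed.

(** This includes [l = 0]: [bad_prob] integrates the label out and keeps only its law. *)
Let good_others N l : <<s others C (inr l) >> (good N).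
Proof.
have := section_prob_measurable P (Th 0%N) (@bad_from_others N l).
move=> /(measurable_lee measurableT) /(_ (measurable_cst eps%:E)).
by rewrite setTI.
Qed.

Let good_measurable N : measurable (good N).
Proof. exact: (sigma_sub_measurable (@others_measurable (inr 0%N))). Qed.

Let bad_others N l l' : l != l' -> <<s others C (inr l') >> (bad N l).
Proof.
move=> ll'.
have mTh : measurable_fun setT (Th l : g_sigma_algebraType (others C (inr l')) -> T).
  exact: (others_measurable_fun (i := inr l)).
have : measurable_fun setT (fun w : g_sigma_algebraType (others C (inr l')) => (w, Th l w)).
  exact: measurable_fun_pair.
by move=> /(_ measurableT _ (@bad_from_others N l')); rewrite setTI.
Qed.

Let few_bad_prob N K :
  fine (P (good N `&` [set w | (eps + eps) * #|[set: 'I_K]%SET|%:R <=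
     \sum_(l in [set: 'I_K]%SET) \1_(bad N l) w]))
  <= expR (- (eps ^+ 2 / 8)) ^+ #|[set: 'I_K]%SET| * fine (P (good N)).
Proof.
have /andP[e0 e1] := eps01.
apply: (@chernoff_meets _ _ _ _ _ (fun l : 'I_K => bad N l)) => //.
- exact: ltW.
- by rewrite (ltW e0).
- by rewrite (ltW e0).
move=> J _; apply: prob_meet_le => //; first exact: ltW.
move=> J' l sJ lJ lJ'.
apply: (label_step indep (ltW e0) (@bad_from_others N l)).
  apply: (@measurableI _ (g_sigma_algebraType (others C (inr (l : nat))))).
    exact: good_others.
  apply: (@fin_bigcap_measurable _ (g_sigma_algebraType (others C (inr (l : nat))))) => //.
  move=> i iJ'; apply: bad_others.
  by apply: contraNneq lJ' => /val_inj <-.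
move=> w [+ _]; rewrite /good /= /bad_prob.
rewrite (same l) //.
exact: measurable_xsection (@bad_from_others N l).
Qed.

Let few_bad_ae N : {ae P, forall w, \forall K \near \oo, good N w ->
  \sum_(l < K) \1_(bad N l) w < (eps + eps) * K%:R}.
Proof.
have /andP[e0 e1] := eps01.
pose rho : R := expR (- (eps ^+ 2 / 8)).
have r0 : 0 < rho by exact: expR_gt0.
have r1 : rho < 1 by rewrite -[ltRHS]expR0 ltr_expR oppr_lt0 divr_gt0 ?exprn_gt0.
pose F K := good N `&` [set w | (eps + eps) * #|[set: 'I_K]%SET|%:R <=
     \sum_(l in [set: 'I_K]%SET) \1_(bad N l) w].
have mF K : measurable (F K).
  apply: measurableI => //; rewrite -[X in measurable X]setTI.
  apply: measurable_fun_le => //; under eq_fun do rewrite big_mkcond.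
  apply: measurable_sum => l; case: (l \in _); last exact: measurable_cst.
  exact: (measurable_indic (bad_measurable N l)).
apply: filterS (borel_cantelli_ae (b := fun K => rho ^+ K)
  (M := 1 / (1 - rho)) mF _ _ _).
- move=> w; apply: filterS => K nF gw; rewrite ltNge; apply/negP => H.
  apply: nF; split => //=; rewrite cardsT card_ord; apply: le_trans H _.
  by rewrite le_eqVlt; apply/orP; left; apply/eqP/eq_bigl => l; rewrite inE.
- by move=> K; rewrite exprn_ge0 // ltW.
- move=> K; have := @geometric_le_lim R K 1 rho ler01 r0.
  by rewrite gtr0_norm // => /(_ r1); rewrite -exprn_geometric /series /= big_mkord.
- apply: nearW => K; apply: le_trans (few_bad_prob N K) _; rewrite cardsT card_ord.
  rewrite -[leRHS]mulr1 ler_wpM2l ?exprn_ge0 ?(ltW r0) //.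
  by rewrite -lee_fin fineK ?fin_num_measure // probability_le1.
Qed.

Hypothesis good0 : eventually_good (Th 0%N).

(** Markov's inequality: off [good N] the conditional probability exceeds [eps], so [eps] times the
    probability that no [N] is good is at most [P (bad N 0)], which tends to 0. *)
Let some_good_ae : {ae P, forall w, exists N, good N w}.
Proof.
have /andP[e0 _] := eps01.
have mC N : measurable (~` good N) by exact: measurableC.
have mCi : measurable (\bigcap_N ~` good N) by exact: bigcap_measurable.
exists (\bigcap_N ~` good N); split=> //; last first.
  by move=> w /= H N _; apply: contra_not H => gN; exists N.
have markov N : (eps%:E * P (\bigcap_N ~` good N) <= P (bad N 0))%E.
  rewrite (sample_sigma_fubini indep 0%N (bad_from_sample N)).
  have mbad : measurable_fun setT (bad_prob N : Omega -> \bar R).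
    exact: (section_prob_measurable_base P (Th 0%N) (@others_measurable (inr 0%N))
      (@bad_from_others N 0%N)).
  apply: (@le_trans _ _ (\int[P]_(w in ~` good N) bad_prob N w)%E); last first.
    exact: ge0_subset_integral.
  apply: (@le_trans _ _ (eps%:E * P (~` good N))%E).
    rewrite lee_pmul2l //; apply: le_measure; rewrite ?inE //.
    by move=> w /(_ N I).
  rewrite -integral_cst //; apply: ge0_le_integral => //.
  - by move=> w _; rewrite lee_fin ltW.
  - exact: measurable_funTS.
  - by move=> w /= /negP; rewrite -ltNge => /ltW.
have H0 : (eps%:E * P (\bigcap_N ~` good N) <= 0)%E.
  have /eventually_goodP cvg0 := good0.
  have := cvg_lim _ cvg0 => <- //.
  apply: lime_ge; first by apply/cvg_ex; exists 0%E.
  by apply: nearW => N; exact: markov.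
apply/eqP; rewrite eq_le measure_ge0 andbT.
by move: H0; rewrite pmule_rle0.
Qed.

Lemma few_bad_labels_ae (k : nat -> nat) :
  {ae P, forall w, \forall n \near \oo,
    \sum_(l < k n) \1_[set w | A (Th l w, sample Z n w)] w <= (eps + eps) * (k n)%:R}.
Proof.
have /andP[e0 _] := eps01.
have each l : eventually_good (Th l).
  apply: (eventually_good_transfer indep indep _ good0).
  by move=> B mB; rewrite (same l).
have := ae_foralln each; have := ae_foralln few_bad_ae; have := some_good_ae.
apply: filterS3 => w [N gN] few ev.
have [K0 _ HK] := few N.
have [M HM] : exists M, forall l, (l < K0)%N -> forall n, (M <= n)%N ->
    ~ A (Th l w, sample Z n w).
  elim: K0 {HK} => [|K [M IHM]]; first by exists 0%N.
  have [M' _ HM'] := ev K; exists (maxn M M') => l.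
  rewrite ltnS leq_eqVlt => /orP[/eqP->|lK] n; rewrite geq_max => /andP[Mn M'n].
    exact: HM'.
  exact: IHM.
exists (maxn N M) => // n /=; rewrite geq_max => /andP[Nn Mn].
(* Being bad at time [n >= N] implies [bad N l], so the bound for [K = k n] labels covers time [n].
   With fewer than [K0] labels, none is bad after [M]. *)
have [kK|kK] := leqP K0 (k n).
  apply: le_trans (ltW (HK _ kK gN)); apply: ler_sum => l _.
  rewrite !indicE; case: (boolP (w \in _)) => [/set_mem An|_]; last exact: ler0n.
  by rewrite mem_set //; exists n.
rewrite big1 ?mulr_ge0 ?addr_ge0 ?(ltW e0) // => l _.
rewrite indicE memNset //=; apply: HM => //.
exact: ltn_trans kK.
Qed.

End ManyLabels.

End BadLabels.

(** * From pointwise to uniform convergence *)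

Section Polya.
Context (R : realType) (F : R -> R).
Hypothesis F_cont : continuous F.
Hypothesis F_incr : {homo F : y y' / y < y'}.
Hypothesis F_ge0 : forall y, 0 <= F y.
Hypothesis F_le1 : forall y, F y <= 1.
Hypothesis F_small : forall e : R, 0 < e -> exists y, F y < e.
Hypothesis F_large : forall e : R, 0 < e -> exists y, 1 - e < F y.

(** A point of level [i / (m + 1)] when [0 < i <= m]; for other [i], [get] may return a default
    point. The family is countable, so the null sets of its points can be united. *)
Definition quantile_grid (m i : nat) : R := get [set y | F y = i%:R / m.+1%:R].

Lemma quantile_gridP m i : (0 < i)%N -> (i <= m)%N ->
  F (quantile_grid m i) = i%:R / m.+1%:R.
Proof.
move=> i0 im; suff [y Fy] : exists y, F y = i%:R / m.+1%:R.
  exact: (@getPex _ [set y | F y = i%:R / m.+1%:R]) (ex_intro _ y Fy).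
have q0 : 0 < i%:R / m.+1%:R :> R by rewrite divr_gt0 // ltr0n.
have q1 : 0 < 1 - i%:R / m.+1%:R :> R.
  by rewrite subr_gt0 ltr_pdivrMr ?ltr0n // mul1r ltr_nat.
have [a Fa] := F_small q0; have [b] := F_large q1; rewrite subKr => Fb.
have ab : a <= b.
  rewrite leNgt; apply/negP => /F_incr ba.
  by have := lt_trans (lt_trans Fa Fb) ba; rewrite ltxx.
have [|c _ Fc] := @IVT R F a b (i%:R / m.+1%:R) ab (continuous_subspaceT F_cont).
  by rewrite ge_min (ltW Fa) le_max (ltW Fb) orbT.
by exists c.
Qed.

(** Between consecutive grid points [F] grows by [1 / (m + 1) < e / 2], and monotonicity of [G n]
    costs the error at a grid point, another [e / 2]. *)
Lemma polya_uniform (G : nat -> R -> R) :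
  (forall n y, 0 <= G n y <= 1) ->
  (forall n, {homo G n : y y' / y <= y'}) ->
  (forall m i, G n (quantile_grid m i) @[n --> \oo] --> F (quantile_grid m i)) ->
  sup (range (fun y => `|G n y - F y|)) @[n --> \oo] --> (0 : R).
Proof.
move=> G01 Gmono Gcvg; apply/cvgr0Pnorm_le => e e0.
have e20 : 0 < e / 2 by rewrite divr_gt0.
pose m := Num.truncn (e / 2)^-1.
have me : m.+1%:R^-1 < e / 2 :> R.
  by rewrite -[ltRHS]invrK ltf_pV2 ?posrE ?ltr0n ?invr_gt0 // truncnS_gt.
have [N HN] : exists N, forall i, (i < m.+1)%N -> forall n, (N <= n)%N ->
    `|G n (quantile_grid m i) - F (quantile_grid m i)| <= e / 2.
  elim: (m.+1) => [|k [M IHM]]; first by exists 0%N.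
  have /cvgrPdist_le /(_ _ e20) [M' _ HM'] := Gcvg m k.
  exists (maxn M M') => i; rewrite ltnS leq_eqVlt.
  move=> /orP[/eqP->|ik] n; rewrite geq_max => /andP[Mn M'n]; last exact: IHM.
  by rewrite distrC; exact: HM'.
exists N => // n /= Nn.
have close y : `|G n y - F y| <= e.
  have /andP[G0 G1] := G01 n y; have F0 := F_ge0 y.
  have F1 : F y < 1 by apply: lt_le_trans (F_le1 (y + 1)); apply: F_incr; rewrite ltrDl.
  (* This [i] places [F y] between [t = i / (m + 1)] and [t + q]. *)
  pose i := Num.truncn (F y * m.+1%:R).
  have m0 : 0 < m.+1%:R :> R by rewrite ltr0n.
  have Fm0 : 0 <= F y * m.+1%:R by rewrite mulr_ge0 // ltW.
  have [q qE] : exists q : R, q = m.+1%:R^-1 by eexists.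
  have [t tE] : exists t : R, t = i%:R / m.+1%:R by eexists.
  rewrite -qE in me.
  have tF : t <= F y by rewrite tE ler_pdivrMr // truncn_le.
  have tqE : i.+1%:R / m.+1%:R = t + q by rewrite tE qE -natr1 mulrDl mul1r.
  have Fi : F y < t + q by rewrite -tqE ltr_pdivlMr // truncnS_gt.
  have im : (i <= m)%N.
    rewrite -ltnS -(ltr_nat R) -(ltr_pM2r (x := m.+1%:R^-1)) ?invr_gt0 //.
    by rewrite divff ?gt_eqF // -tE; exact: le_lt_trans F1.
  rewrite ler_norml; apply/andP; split.
    (* For [i = 0] no grid point lies below [y]; then [F y < q], and [G n y >= 0] suffices. *)
    have [i0|i0] := posnP i; first by rewrite i0 mul0r in tE; lra.
    have gy : quantile_grid m i <= y.
      rewrite leNgt; apply/negP => /F_incr; rewrite quantile_gridP // -tE => h.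
      by have := lt_le_trans h tF; rewrite ltxx.
    have := HN i im n Nn; rewrite quantile_gridP // -tE ler_norml => /andP[h _].
    by have := Gmono n _ _ gy; lra.
  have [im'|im'] := ltnP i m.
    have gy : y <= quantile_grid m i.+1.
      rewrite leNgt; apply/negP => /F_incr; rewrite quantile_gridP // tqE => h.
      by have := lt_trans h Fi; rewrite ltxx.
    have := HN i.+1 im' n Nn; rewrite quantile_gridP // tqE ler_norml => /andP[_ h].
    by have := Gmono n _ _ gy; lra.
  (* No grid point lies above [y]; then [t + q = 1], and [G n y <= 1] suffices. *)
  have iE : i = m by apply/eqP; rewrite eqn_leq im.
  by move: tqE; rewrite iE divff ?gt_eqF // => tqE; lra.
have nonempty : range (fun y => `|G n y - F y|) !=set0 by exists `|G n 0 - F 0|; exists 0.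
rewrite ger0_norm; first by apply: ge_sup => // _ [y _ <-]; exact: close.
apply: le_trans (normr_ge0 (G n 0 - F 0)) _; apply: ub_le_sup; last by exists 0.
by exists e => _ [y _ <-]; exact: close.
Qed.

End Polya.

(** * Lower bounds from the mean and the coefficient of variation *)

Section CoefficientOfVariation.
Context d (Omega : measurableType d) (R : realType) (P : probability Omega R).

Lemma measurable_lt_set (N : {mfun Omega >-> R}) (c : R) :
  measurable [set w | N w < c].
Proof.
rewrite (_ : mkset _ = ~` [set w | c <= N w]); last first.
  by apply/seteqP; split=> w /=; rewrite ltNge => /negP.
apply: measurableC; rewrite -[X in measurable X]setTI.
exact: measurable_fun_le.
Qed.

Lemma bounded_variance_fin (N : {RV P >-> R}) (M : R) : (forall w, `|N w| <= M) ->
  'V_P[N]%E \is a fin_num.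
Proof.
move=> NM; rewrite ge0_fin_numE ?variance_ge0 // /variance unlock.
set c := fine _; rewrite unlock.
apply: (@le_lt_trans _ _ (\int[P]_(w in setT) (((M + `|c|) ^+ 2)%:E))%E); last first.
  rewrite integral_cst // lte_mul_pinfty ?lee_fin ?sqr_ge0 //.
  by rewrite (le_lt_trans (probability_le1 P measurableT)) ?ltry.
have mNc : measurable_fun setT (N \- cst c).
  by apply: measurable_funB => //; exact: measurable_cst.
apply: ge0_le_integral => //.
- by move=> w _; rewrite lee_fin -expr2 sqr_ge0.
- by apply/measurable_EFinP; exact: measurable_funM.
- move=> w _; rewrite lee_fin -expr2 /= -[leLHS]real_normK ?num_real //.
  have M0 : 0 <= M by apply: le_trans (NM w).
  rewrite lerXn2r ?nnegrE ?addr_ge0 //.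
  by apply: le_trans (ler_normB _ _) _; rewrite lerD2r.
Qed.

(** Falling below half the mean is a deviation of at least half the mean, for which Chebyshev's
    inequality gives four times the squared coefficient of variation. *)
Lemma lower_tail_CV (N : {RV P >-> R}) (M : R) : (forall w, `|N w| <= M) ->
  0 < fine 'E_P[N]%E ->
  fine (P [set w | N w < fine 'E_P[N]%E / 2]) <= 4 * CV P N ^+ 2.
Proof.
move=> NM; set e := fine 'E_P[N]%E => e0.
have e20 : 0 < e / 2 by rewrite divr_gt0.
have mN : measurable_fun setT (N : Omega -> R) by [].
have mlow := measurable_lt_set N (e / 2).
have mdev : measurable [set w | e / 2 <= `|N w - e|].
  rewrite -[X in measurable X]setTI; apply: measurable_fun_le => //.
  apply: measurableT_comp => //; apply: measurable_funB => //.
have Vfin := bounded_variance_fin NM.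
rewrite -lee_fin fineK ?fin_num_measure //.
apply: (@le_trans _ _ (P [set w | e / 2 <= `|N w - e|])).
  apply: le_measure; rewrite ?inE // => w /= h.
  by rewrite ler_normr; apply/orP; right; lra.
apply: le_trans (chebyshev N e20) _.
have -> : CV P N ^+ 2 = fine 'V_P[N]%E / e ^+ 2.
  by rewrite /CV -/e expr_div_n sqr_sqrtr // fine_ge0 // variance_ge0.
rewrite -{1}(fineK Vfin) -EFinM lee_fin.
rewrite le_eqVlt; apply/orP; left; apply/eqP.
by field; rewrite gt_eqF.
Qed.

Lemma CV_lower_bound_ae (N : nat -> {RV P >-> R}) (alpha beta gamma : R) :
  0 < alpha -> 1 < beta -> 1 < gamma ->
  (forall n w, 0 <= N n w <= n%:R) ->
  (fun n => fine ('E_P[N n])%E) \is 'Omega_\oo (rate beta) ->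
  (fun n => CV P (N n)) =O_\oo
    (fun n => (n%:R `^ ((alpha + 1) / 2) * (ln n%:R) `^ (gamma / 2))^-1 : R) ->
  {ae P, forall w, \forall n \near \oo, (log2 n ^ 3)%:R <= N n w}.
Proof.
move=> a0 b1 g1 Nn; rewrite qualifE => /asboolP[K K0 EK] /eqO_exP[C C0 CVC].
have NM n w : `|N n w| <= n%:R by have /andP[h0 h1] := Nn n w; rewrite ger0_norm.
have E0 n : 0 <= fine ('E_P[N n])%E.
  by apply: fine_ge0; apply: expectation_ge0 => w; have /andP[] := Nn n w.
(* [4 * C ^+ 2] comes from [lower_tail_CV], the power of 2 from [n + 1 <= 2 * n], which turns the
   bound into a term of the series of [p_series_le]. *)
pose M : R := 4 * C ^+ 2 * 2 `^ (1 + alpha).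
have M0 : 0 <= M by rewrite !mulr_ge0 ?powR_ge0 ?exprn_ge0 // ltW.
have K20 : 0 < K / 2 by rewrite divr_gt0.
have HE : \forall n \near \oo, (log2 n ^ 3)%:R <= fine ('E_P[N n])%E / 2.
  apply: filterS2 EK (rate_ge_log2_cube K20 b1) => n EKn /le_trans; apply.
  rewrite ler_pdivlMr // mulrAC divfK //; move: EKn; rewrite (ger0_norm (E0 n)).
  by apply: le_trans; rewrite ler_pM2l // ler_norm.
have HCV : \forall n \near \oo, 4 * CV P (N n) ^+ 2 <= M * ((n.+1)%:R `^ (1 + alpha))^-1.
  have large : \forall n \near \oo, 1 <= ln n%:R :> R.
    exists (Num.truncn (expR 1 : R)).+1 => // n /= hn.
    rewrite -[leLHS]expRK ler_ln ?posrE ?expR_gt0 ?ltr0n ?(leq_ltn_trans _ hn) //.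
    by apply: ltW; apply: lt_le_trans (truncnS_gt _) _; rewrite ler_nat.
  apply: filterS2 CVC large => n CVn ln1.
  have n0 : (0 < n)%N.
    by rewrite lt0n; apply: contraTneq ln1 => ->; rewrite ln0 // -ltNge ltr01.
  have n1R : 1 <= n%:R :> R by rewrite ler1n.
  have n0R : 0 < n%:R :> R by rewrite ltr0n.
  have CV0 : 0 <= CV P (N n) by rewrite divr_ge0 ?sqrtr_ge0.
  have CVn1 : CV P (N n) <= C * (n%:R `^ ((alpha + 1) / 2))^-1.
    move: CVn; rewrite (ger0_norm CV0) => /le_trans; apply; rewrite ler_pM2l //.
    rewrite ger0_norm ?invr_ge0 ?mulr_ge0 ?powR_ge0 //.
    rewrite lef_pV2 ?posrE ?mulr_gt0 ?powR_gt0 ?(lt_le_trans ltr01) //.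
    rewrite ler_peMr ?powR_ge0 // -[leLHS](powRr0 (ln n%:R)) ler_powR // divr_ge0 //.
    by rewrite ltW // (lt_trans ltr01).
  apply: (@le_trans _ _ (4 * (C * (n%:R `^ ((alpha + 1) / 2))^-1) ^+ 2)).
    rewrite ler_pM2l // lerXn2r ?nnegrE //; exact: le_trans CVn1.
  have sq : (n%:R `^ ((alpha + 1) / 2)) ^+ 2 = n%:R `^ (alpha + 1).
    by rewrite -powR_mulrn ?powR_ge0 // -powRrM divfK.
  rewrite exprMn exprVn sq /M.
  rewrite -!mulrA !ler_pM2l ?exprn_gt0 // (addrC alpha).
  rewrite -ler_pdivrMl ?powR_gt0 // -invfM lef_pV2 ?posrE ?mulr_gt0 ?powR_gt0 ?ltr0n //.
  rewrite -powRM ?ler0n // ge0_ler_powR ?nnegrE ?mulr_ge0 ?ler0n //.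
    by rewrite addr_ge0 // ltW.
  by rewrite mulr_natl mulr2n -natrD ler_nat -addn1 leq_add2l.
pose F n := [set w | N n w < (log2 n ^ 3)%:R].
have mF n : measurable (F n) by exact: measurable_lt_set.
apply: filterS (borel_cantelli_ae (b := fun n => M * ((n.+1)%:R `^ (1 + alpha))^-1)
  (M := M * (1 + alpha^-1)) mF _ _ _).
- by move=> w; apply: filterS => n /negP; rewrite /= -leNgt.
- by move=> n; rewrite mulr_ge0 ?invr_ge0 ?powR_ge0.
- by move=> n; rewrite -mulr_sumr ler_wpM2l // p_series_le.
- apply: filterS2 HE HCV => n En; apply: le_trans.
  apply: le_trans (lower_tail_CV (NM n) _); last first.
    rewrite -(ltr_pM2r (x := 2^-1)) ?invr_gt0 // mul0r; apply: lt_le_trans En.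
    by rewrite ltr0n expn_gt0.
  have mlow := measurable_lt_set (N n) (fine ('E_P[N n])%E / 2).
  apply: fine_le; rewrite ?fin_num_measure //.
  apply: le_measure; rewrite ?inE //.
  by move=> w /= /lt_le_trans; apply.
Qed.

End CoefficientOfVariation.

(** * Measurability of the leaf statistics, and counts of bootstrap draws *)

Section FiniteValued.
Context d (T : measurableType d) (R : realType).

Lemma measurable_fun_finite_valued (I : finType) (phi : T -> I) (g : I -> T -> R) :
  (forall i, measurable [set t | phi t = i]) -> (forall i, measurable_fun setT (g i)) ->
  measurable_fun setT (fun t => g (phi t) t).
Proof.
move=> mphi mg.
rewrite (_ : (fun t => _) = fun t => \sum_i \1_[set t | phi t = i] t * g i t).
  apply: measurable_sum => i; apply: measurable_funM => //.
apply/funext => t; rewrite (bigD1 (phi t)) //= indicE mem_set // mul1r big1 ?addr0 //.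
by move=> i it; rewrite indicE memNset ?mul0r // => /= pti; rewrite pti eqxx in it.
Qed.

End FiniteValued.

Section LeafMeasurability.
Context (R : realType) (d : nat) dT (T : measurableType dT) (n : nat).
Context (Lf : T * n.-tuple (obs R d) -> set (xvec R d)).
Hypothesis mLf : forall i, measurable [set q | Lf q (xs q.2 i)].

(** The leaf enters its statistics only through this finite index set, so measurability of the
    membership of each sample point is enough. *)
Let trace (q : T * n.-tuple (obs R d)) := [set i | xs q.2 i \in Lf q]%SET.

Let trace_measurable J : measurable [set q | trace q = J].
Proof.
pose A j := [set q | Lf q (xs q.2 j)].
rewrite (_ : mkset _ = \bigcap_(j in [set: 'I_n]) (if j \in J then A j else ~` A j)).
  apply: fin_bigcap_measurable => // j _; case: ifP => _; first exact: mLf.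
  by apply: measurableC; exact: mLf.
have AE q j : A j q <-> j \in trace q.
  by rewrite inE; split=> [/mem_set|/set_mem].
apply/seteqP; split=> q /=.
  move=> <- j _; case: ifP => jq; first exact/AE.
  by move/AE; rewrite jq.
move=> H; apply/setP => j; have := H j I.
by case: ifP => jJ /AE //; move/negP/negbTE.
Qed.

Lemma leaf_mean_measurable y :
  measurable_fun setT (fun q => leaf_mean q.2 (Lf q) y).
Proof.
pose g (J : {set 'I_n}) (q : T * n.-tuple (obs R d)) : R :=
  (\sum_(j in J) (ys q.2 j <= y)%R%:R) / #|J|%:R.
rewrite (_ : (fun q => _) = fun q => g (trace q) q).
  apply: measurable_fun_finite_valued => // J.
  apply: measurable_funM; last exact: measurable_cst.
  under eq_fun do rewrite big_mkcond.
  apply: measurable_sum => j; case: (j \in J); last exact: measurable_cst.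
  have mB : measurable [set q : T * n.-tuple (obs R d) | ys q.2 j <= y].
    rewrite -[X in measurable X]setTI; apply: measurable_fun_le => //.
    apply: (measurableT_comp measurable_snd).
    by apply: (measurableT_comp (measurable_tnth j)).
  rewrite (_ : (fun q => _) = \1_[set q : T * n.-tuple (obs R d) | ys q.2 j <= y]).
    exact: measurable_indic.
  apply/funext => q; rewrite indicE; case: (boolP (ys q.2 j <= y)) => h.
    by rewrite mem_set.
  by rewrite memNset //; exact/negP.
apply/funext => q; rewrite /leaf_mean /g NoE; congr (_ / _).
by apply: eq_bigl => j; rewrite inE.
Qed.

Lemma Nb_measurable (b : T -> {ffun 'I_n -> 'I_n}) :
  (forall s, measurable [set t | b t = s]) ->
  measurable_fun setT (fun q => (Nb (b q.1) q.2 (Lf q))%:R : R).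
Proof.
move=> mb; pose g (J : {set 'I_n}) (q : T * n.-tuple (obs R d)) : R :=
  \sum_(j in J) (mult (b q.1) j)%:R.
rewrite (_ : (fun q => _) = fun q => g (trace q) q).
  apply: measurable_fun_finite_valued => // J; rewrite /g.
  under eq_fun do rewrite big_mkcond.
  apply: measurable_sum => j; case: (j \in J); last exact: measurable_cst.
  apply: (@measurable_fun_finite_valued _ _ _ _ (fun q => b q.1)
    (fun s _ => (mult s j)%:R)) => [s|s]; last exact: measurable_cst.
  have : measurable_fun setT (fst : T * n.-tuple (obs R d) -> T) by [].
  by move=> /(_ measurableT _ (mb s)); rewrite setTI.
apply/funext => q; rewrite /Nb /g natr_sum.
by apply: eq_bigl => j; rewrite inE.
Qed.

End LeafMeasurability.

Lemma Nb_le_mult_No (R : realType) d n (s : {ffun 'I_n -> 'I_n}) (D : n.-tuple (obs R d))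
    (S : set (xvec R d)) m :
  (forall j, (mult s j <= m)%N) -> (Nb s D S <= No D S * m)%N.
Proof.
move=> sm; rewrite /Nb /No -sum_nat_const.
by apply: leq_sum => j _; exact: sm.
Qed.

Lemma sum_mult n (s : {ffun 'I_n -> 'I_n}) : (\sum_j mult s j)%N = n.
Proof.
rewrite /mult; under eq_bigr do rewrite -sum1_card big_mkcond.
rewrite exchange_big /= -[RHS](card_ord n) -sum1_card; apply: eq_bigr => i _.
by rewrite (bigD1 (s i)) //= inE eqxx big1 // => j; rewrite inE eq_sym => /negbTE ->.
Qed.

Lemma Nb_le (R : realType) d n (s : {ffun 'I_n -> 'I_n}) (D : n.-tuple (obs R d))
    (S : set (xvec R d)) : (Nb s D S <= n)%N.
Proof.
by rewrite -[leqRHS](sum_mult s) /Nb big_mkcond; apply: leq_sum => j _; case: ifP.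
Qed.

(** * Pointwise convergence of the forest estimate *)

Section RandomForest.
Context (R : realType) (dO : measure_display) (Omega : measurableType dO).
Context (P : probability Omega R) (d : nat) (u v : 'I_d -> R).
Context (X : {RV P >-> (xvec R d)}) (Y : {RV P >-> R}).
Context (Q : R.-pker (xvec R d) ~> R) (condQ : conditional_law P X Y Q).
Context (Z : nat -> {RV P >-> (obs R d)}).
Hypothesis Z_copies : forall j, same_law P (Z j) (fun w => (X w, Y w)).
Context (d1 d2 : measure_display) (T1 : measurableType d1) (T2 : measurableType d2).
Context (Theta : {RV P >-> (T1 * T2)%type}) (Thetas : nat -> {RV P >-> (T1 * T2)%type}).
Hypothesis Theta_copies : forall l, same_law P (Thetas l) Theta.
Hypothesis indep : mutually_independent P (joint_family (fun j : nat => Z j : Omega -> _)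
  (fun l : nat => Thetas l : Omega -> _)).
Hypothesis indep_generic : mutually_independent P
  (joint_family (fun j : nat => Z j : Omega -> _) (fun _ : unit => Theta : Omega -> _)).
Context (boot : forall n, T1 -> {ffun 'I_n -> 'I_n}).
Hypothesis boot_meas : forall n s, measurable [set t | boot n t = s].
Hypothesis boot_unif : forall n s,
  P [set w | boot n (Theta w).1 = s] = (((n ^ n)%:R : R)^-1)%:E.
Context (tr : forall n, (T1 * T2)%type -> n.-tuple (obs R d) -> tree R d).
Context (x : xvec R d).

Let L n (q : (T1 * T2) * n.-tuple (obs R d)) : set (xvec R d) :=
  leaf (tr q.1 q.2) (root_node u v) x.

Hypothesis tr_meas : forall n (i : 'I_n), measurable [set q | L q (xs q.2 i)].

Let Nbx n w : R :=
  (Nb (boot n (Theta w).1) (sample Z n w) (L (Theta w, sample Z n w)))%:R.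

Let boot_fst_measurable n s : measurable [set t : T1 * T2 | boot n t.1 = s].
Proof.
have : measurable_fun setT (fst : T1 * T2 -> T1) by [].
by move=> /(_ measurableT _ (@boot_meas n s)); rewrite setTI.
Qed.

Let Nbx_measurable n : measurable_fun setT (Nbx n).
Proof.
have mN := Nb_measurable (@tr_meas n) (@boot_fst_measurable n).
have mpair : measurable_fun setT (fun w => (Theta w, sample Z n w)).
  apply: measurable_fun_pair; first exact: measurable_funPT.
  by apply: (@sample_measurable _ _ _ _ Z _ Omega id) => j; exact: measurable_funPT.
exact: (measurableT_comp mN mpair).
Qed.

Let NbX n : {RV P >-> R} := HB.pack_for {mfun Omega >-> R} (Nbx n)
  (isMeasurableFun.Build _ _ Omega R (Nbx n) (@Nbx_measurable n)).

Let few_bootstrapped n : set ((T1 * T2) * n.-tuple (obs R d)) :=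
  [set q | (Nb (boot n q.1.1) q.2 (L q) < log2 n ^ 3)%N].

Let few_bootstrapped_measurable n : measurable (@few_bootstrapped n).
Proof.
have mN := Nb_measurable (@tr_meas n) (@boot_fst_measurable n).
rewrite (_ : @few_bootstrapped n = ~` [set q | (log2 n ^ 3)%:R <=
    ((Nb (boot n q.1.1) q.2 (L q))%:R : R)]).
  apply: measurableC; rewrite -[X in measurable X]setTI.
  exact: measurable_fun_le.
by rewrite /few_bootstrapped; apply/seteqP; split=> q /=; rewrite ler_nat ltnNge => /negP.
Qed.

Lemma bootstrap_leaf_ae (alpha : R) : 0 < alpha ->
  (exists2 beta : R, 1 < beta & {ae P, forall w,
     (fun n => Nbx n w) \is 'Omega_\oo (rate beta)}) \/
  (exists beta gamma : R, [/\ 1 < beta, 1 < gamma &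
     (fun n => fine ('E_P[Nbx n])%E) \is 'Omega_\oo (rate beta) /\
     (fun n => CV P (Nbx n)) =O_\oo
       (fun n => (n%:R `^ ((alpha + 1) / 2) *
                  (ln n%:R) `^ (gamma / 2))^-1 : R)]) ->
  {ae P, forall w, \forall n \near \oo, (log2 n ^ 3)%:R <= Nbx n w}.
Proof.
move=> a0 [[beta b1]|[beta [gamma [b1 g1 [EN CVN]]]]].
  apply: filterS => w; rewrite qualifE => /asboolP[K K0 NK].
  apply: filterS2 NK (rate_ge_log2_cube K0 b1) => n NKn /le_trans; apply.
  move: NKn; rewrite [X in _ <= X]ger0_norm ?ler0n //; apply: le_trans.
  by rewrite ler_pM2l // ler_norm.
apply: (@CV_lower_bound_ae _ _ _ P NbX alpha beta gamma) => //.
by move=> n w; rewrite /= ler0n ler_nat Nb_le.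
Qed.

(** The bound on the generic [Theta] is first carried to [Thetas 0], the label to which (A) will be
    applied. When no multiplicity reaches [log2 n], passing from draws to observations loses one
    factor [log2 n]. *)
Lemma leaf_sample_ae :
  {ae P, forall w, \forall n \near \oo, (log2 n ^ 3)%:R <= Nbx n w} ->
  {ae P, forall w, \forall n \near \oo,
    (log2 n ^ 2 <= No (sample Z n w) (L (Thetas 0%N w, sample Z n w)))%N}.
Proof.
move=> Nlarge.
have goodT : eventually_good P Z few_bootstrapped Theta.
  apply: filterS Nlarge => w; apply: filterS => n.
  by rewrite ler_nat => h; rewrite /few_bootstrapped /= ltnNge h.
have good0 : eventually_good P Z few_bootstrapped (Thetas 0%N).
  apply: (eventually_good_transfer few_bootstrapped_measurable (l := tt)
    indep_generic indep _ goodT) => B mB.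
  by rewrite Theta_copies.
have few_mult : {ae P, forall w, \forall n \near \oo,
    ~ exists j, (log2 n <= mult (boot n (Thetas 0%N w).1) j)%N}.
  have mbw n s : measurable [set w | boot n (Thetas 0%N w).1 = s].
    have := measurable_funPT (Thetas 0%N).
    by move=> /(_ measurableT _ (boot_fst_measurable s)); rewrite setTI.
  have mbP n s : P [set w | boot n (Thetas 0%N w).1 = s] = (((n ^ n)%:R : R)^-1)%:E.
    by rewrite -(boot_unif s); exact: (Theta_copies 0%N (boot_fst_measurable s)).
  pose F n := [set w | exists j, (log2 n <= mult (boot n (Thetas 0%N w).1) j)%N].
  apply: (borel_cantelli_ae (F := F) (b := fun n => 8 ^+ 8 * ((n.+1)%:R ^+ 2)^-1)
    (M := 8 ^+ 8 * 2)).
  - move=> n; rewrite (_ : F n = \bigcup_(s in [set` [pred s : {ffun 'I_n -> 'I_n} |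
        [exists j, (log2 n <= mult s j)%N]]]) [set w | boot n (Thetas 0%N w).1 = s]).
      by apply: fin_bigcup_measurable.
    apply/seteqP; split=> w /=.
      move=> [j hj]; exists (boot n (Thetas 0%N w).1) => //=.
      by rewrite inE; apply/existsP; exists j.
    by move=> [s /=]; rewrite inE => /existsP[j hj] sE; exists j; rewrite sE.
  - by move=> n; rewrite mulr_ge0 ?invr_ge0 ?exprn_ge0.
  - by move=> n; rewrite -mulr_sumr ler_wpM2l ?exprn_ge0 // inv_square_series_le.
  - apply: nearW => n; apply: le_trans (log2_fact_small R n).
    exact: (mult_tail _ (mbw n) (mbP n)).
apply: filterS2 good0 few_mult => w; apply: filterS2 => n nfew nmult.
have mult_le j : (mult (boot n (Thetas 0%N w).1) j <= log2 n)%N.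
  by rewrite leqNgt; apply/negP => /ltnW h; apply: nmult; exists j.
have l0 : (0 < log2 n)%N by [].
rewrite -(leq_pmul2r l0) -expnSr.
apply: leq_trans (Nb_le_mult_No _ _ mult_le).
by rewrite leqNgt; apply/negP.
Qed.

Context (k : nat -> nat) (k_pos : forall n, (0 < k n)%N).

(** Both hypotheses concern label 0 alone: they make it eventually not [far], and
    [few_bad_labels_ae] extends this to most trees. *)
Lemma forest_cdf_cvg_ae y :
  {ae P, forall w, \forall n \near \oo,
    (log2 n ^ 2 <= No (sample Z n w) (L (Thetas 0%N w, sample Z n w)))%N} ->
  {ae P, forall w, sup [set `|cond_cdf Q y z - cond_cdf Q y x| |
     z in L (Thetas 0%N w, sample Z n w)] @[n --> \oo] --> (0 : R)} ->
  {ae P, forall w, forest_cdf (sample Z n w) (k n)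
     (fun l => L (Thetas l w, sample Z n w)) y @[n --> \oo] --> cond_cdf Q y x}.
Proof.
move=> large small; set c := cond_cdf Q y x.
have c01 : 0 <= c <= 1 by rewrite cond_cdf_ge0 cond_cdf_le1.
have Lconvex n q : order_convex (@L n q).
  by apply: leaf_order_convex; exact: box_order_convex.
(* A vanishing proportion of far trees costs at most eps, as all means lie in [0, 1]. *)
suff close (eps : R) : 0 < eps <= 1 -> {ae P, forall w, \forall n \near \oo,
    `|forest_cdf (sample Z n w) (k n) (fun l => L (Thetas l w, sample Z n w)) y - c|
      <= 4 * eps}.
  have eps01 m : 0 < (m.+1%:R^-1 : R) <= 1 by rewrite invr_gt0 ltr0n invf_le1 ?ltr0n // ler1n.
  apply: filterS (ae_foralln (fun m => close _ (eps01 m))) => w H.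
  apply/cvgrPdist_le => e e0.
  pose m := Num.truncn (e / 4)^-1.
  apply: filterS (H m) => n; rewrite distrC => /le_trans; apply.
  rewrite -ler_pdivlMl // mulrC -[leRHS]invrK lef_pV2 ?posrE ?ltr0n ?invr_gt0 ?divr_gt0 //.
  by rewrite ltW // truncnS_gt.
move=> eps01; have /andP[e0 e1] := eps01.
pose far n : set ((T1 * T2) * n.-tuple (obs R d)) :=
  [set q | ~ `|leaf_mean q.2 (L q) y - c| <= 2 * eps].
have mfar n : measurable (@far n).
  apply: measurableC; rewrite -[X in measurable X]setTI.
  apply: measurable_fun_le => //; apply: measurableT_comp => //.
  apply: measurable_funB => //; exact: (leaf_mean_measurable (@tr_meas n)).
have good0 : eventually_good P Z far (Thetas 0%N).
  have mean_close := leaf_mean_close_ae condQ Z_copies (mutually_independent_left indep)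
    y c01 eps01.
  move: large small mean_close; apply: filterS3 => w large_w /cvgr0Pnorm_le /(_ _ e0) small_w.
  apply: filterS3 large_w small_w => n No_n sup_n mean_n; apply; apply: mean_n => //.
  move=> j /set_mem jL; apply: le_trans sup_n; apply: le_trans (ler_norm _).
  apply: ub_le_sup; last by exists (xs (sample Z n w) j).
  exists 1 => _ [z _ <-]; rewrite -/c ler_norml.
  have := cond_cdf_ge0 Q y z; have := cond_cdf_le1 Q y z.
  by move: c01 => /andP[? ?] ? ?; apply/andP; split; lra.
have same l : same_law P (Thetas l) (Thetas 0%N).
  by move=> B mB; rewrite !Theta_copies.
apply: filterS (few_bad_labels_ae mfar indep same eps01 good0 k) => w.
apply: filterS => n few.
have kn0 : 0 < (k n)%:R :> R by rewrite ltr0n.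
rewrite forest_cdf_mean -(ler_pM2l kn0) -{1}(ger0_norm (ltW kn0)) -normrM mulrBr.
rewrite mulVKf ?gt_eqF // (_ : _ * c = \sum_(l < k n) c); last first.
  by rewrite sumr_const card_ord mulr_natl.
rewrite -sumrB.
apply: le_trans (ler_norm_sum _ _ _) _.
(* A near tree contributes at most [2 * eps] and a far one at most 1; as far trees have proportion
   at most [eps + eps], the total is [4 * eps]. *)
apply: (@le_trans _ _ (\sum_(l < k n) (2 * eps +
    \1_[set w | far n (Thetas l w, sample Z n w)] w))).
  apply: ler_sum => l _; rewrite indicE.
  have [far_l|near_l] := pselect (far n (Thetas l w, sample Z n w)); last first.
    by rewrite memNset // addr0; apply: contrapT.
  rewrite mem_set //; apply: (@le_trans _ _ 1); last by rewrite lerDr mulr_ge0 // ltW.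
  rewrite ler_norml.
  have := leaf_mean_ge0 (sample Z n w) (L (Thetas l w, sample Z n w)) y.
  have := leaf_mean_le1 (sample Z n w) (L (Thetas l w, sample Z n w)) y.
  by move: c01 => /andP[? ?] ? ?; apply/andP; split; lra.
rewrite big_split /= sumr_const card_ord -mulr_natl.
apply: le_trans (lerD (lexx _) few) _.
by rewrite le_eqVlt; apply/orP; left; apply/eqP; ring.
Qed.

End RandomForest.

Theorem theorem4p3
  (R : realType) (dO : measure_display) (Omega : measurableType dO)
  (P : probability Omega R)
  (* the pair (X, Y), the covariate space, the conditional distribution *)
  (d : nat) (u v : 'I_d -> R)
  (X : {RV P >-> (xvec R d)}) (Y : {RV P >-> R})
  (X_in_box : forall w, box u v (X w))
  (Q : R.-pker (xvec R d) ~> R) (condQ : conditional_law P X Y Q)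
  (* the observations Z j = (X^j, Y^j) *)
  (Z : nat -> {RV P >-> (obs R d)})
  (Z_copies : forall j, same_law P (Z j) (fun w => (X w, Y w)))
  (* the generic Theta = (Theta^1, Theta^2), its copies Thetas l *)
  (d1 d2 : measure_display) (T1 : measurableType d1) (T2 : measurableType d2)
  (Theta : {RV P >-> (T1 * T2)%type}) (Thetas : nat -> {RV P >-> (T1 * T2)%type})
  (Theta_copies : forall l, same_law P (Thetas l) Theta)
  (indep : mutually_independent P (joint_family (fun j : nat => Z j : Omega -> _)
     (fun l : nat => Thetas l : Omega -> _)))
  (indep_generic : mutually_independent P (joint_family (fun j : nat => Z j : Omega -> _)
     (fun _ : unit => Theta : Omega -> _)))
  (* bootstrap indices encoded by Theta^1 *)
  (boot : forall n, T1 -> {ffun 'I_n -> 'I_n})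
  (boot_meas : forall n s, measurable [set t | boot n t = s])
  (boot_unif : forall n s,
     P [set w | boot n (Theta w).1 = s] = (((n ^ n)%:R : R)^-1)%:E)
  (* candidate split variables given, at each node, by Theta^2 *)
  (mtry : nat -> T2 -> seq bool -> {set 'I_d})
  (mtry_meas : forall n a M, measurable [set t | mtry n t a = M])
  (mtry_pos : forall n a i, (0 < P [set w | i \in mtry n (Theta w).2 a])%E)
  (* the trees *)
  (stop : forall n, n.-tuple (obs R d) -> seq bool -> node R d -> bool)
  (tr : forall n, (T1 * T2)%type -> n.-tuple (obs R d) -> tree R d)
  (tr_cart : forall n th D,
     cart_tree (boot n th.1) D (mtry n th.2) (stop n) [::] (root_node u v) (tr n th D))
  (tr_meas : forall n x (i : 'I_n), box u v x ->
     measurable [set p : (T1 * T2) * n.-tuple (obs R d) |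
       leaf (tr n p.1 p.2) (root_node u v) x (xs p.2 i)])
  (* the number of trees *)
  (k : nat -> nat) (k_pos : forall n, (0 < k n)%N) :
  let F := cond_cdf Q in
  let Dn n w : n.-tuple (obs R d) := [tuple Z j w | j < n] in
  let An x n th w := leaf (tr n th (Dn n w)) (root_node u v) x in
  let Nbx x n w : R :=
    (Nb (boot n (Theta w).1) (Dn n w) (An x n (Theta w) w))%:R in
  let Fo y x n w :=
    forest_cdf (Dn n w) (k n) (fun l => An x n (Thetas l w) w) y in
  (* (A) *)
  (forall l, (exists n, (l < k n)%N) -> forall x y, box u v x ->
     {ae P, forall w,
       sup [set `|F y z - F y x| | z in An x n (Thetas l w) w]
         @[n --> \oo] --> (0 : R)}) ->
  (* (B) *)
  (exists alpha : R,
     [/\ 0 < alpha,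
         (fun n => (k n)%:R : R) =O_\oo (fun n => n%:R `^ alpha : R) &
         (exists2 beta : R, 1 < beta &
            forall x, box u v x -> {ae P, forall w,
              (fun n => Nbx x n w) \is 'Omega_\oo (rate beta)})
         \/
         (exists beta gamma : R, [/\ 1 < beta, 1 < gamma &
            forall x, box u v x ->
              (fun n => fine ('E_P[Nbx x n])%E) \is 'Omega_\oo (rate beta) /\
              (fun n => CV P (Nbx x n)) =O_\oo
                (fun n => (n%:R `^ ((alpha + 1) / 2) *
                           (ln n%:R) `^ (gamma / 2))^-1 : R)])]) ->
  (* (C) *)
  (forall x, box u v x ->
     continuous (fun y => F y x) /\ {homo (fun y => F y x) : y y' / y < y'}) ->
  forall x, box u v x ->
    {ae P, forall w,
      sup (range (fun y => `|Fo y x n w - F y x|)) @[n --> \oo] --> (0 : R)}.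
Proof.
move=> F Dn An Nbx Fo HA [alpha [a0 _ HB]] HC x xbox.
have mL n (i : 'I_n) : measurable [set q : (T1 * T2) * n.-tuple (obs R d) |
    leaf (tr n q.1 q.2) (root_node u v) x (xs q.2 i)] by exact: tr_meas.
have large : {ae P, forall w, \forall n \near \oo, (log2 n ^ 3)%:R <= Nbx x n w}.
  apply: (bootstrap_leaf_ae boot_meas mL a0).
  case: HB => [[beta b1 /(_ x xbox) H]|[beta [gamma [b1 g1 /(_ x xbox) H]]]].
    by left; exists beta.
  by right; exists beta, gamma.
have enough := leaf_sample_ae Theta_copies indep indep_generic boot_meas boot_unif mL large.
have [Fcont Fincr] := HC x xbox.
(* Tree 0 is grown since [k 0 > 0], so (A) applies to it. *)
have cvgF y := forest_cdf_cvg_ae condQ Z_copies Theta_copies indep mL k_pos enough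
  (HA 0%N (ex_intro _ 0%N (k_pos 0%N)) x y xbox).
pose grid m i := quantile_grid (fun y => F y x) m i.
(* One null set serves for the whole countable grid of quantiles. *)
apply: filterS (ae_foralln (fun m => ae_foralln (fun i => cvgF (grid m i)))) => w cvgw.
apply: (@polya_uniform R (fun y => F y x)) => //.
- by move=> y; exact: cond_cdf_ge0.
- by move=> y; exact: cond_cdf_le1.
- by move=> e; exact: cond_cdf_small.
- by move=> e; exact: cond_cdf_large.
- by move=> n y; exact: forest_cdf_01.
- by move=> n; exact: forest_cdf_homo.
Qed.
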